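(* Every maximal subgroup of the Basilica group $\mathcal{B}$ is of finite index in $\mathcal{B}$.
   Context: Let $X=\{\boldsymbol{0},\boldsymbol{1}\}$ and let $X^*$ be the rooted tree whose vertices are the finite words over $X$, with the empty word as root, two words being adjacent if one is a prefix of the other and their lengths differ by exactly $1$. The Basilica group is $\mathcal{B}=\langle a,b\rangle\leq\mathrm{Aut}(X^* )$, where $a,b$ are the automorphisms (acting on the left, fixing the empty word) defined recursively for $w\in X^*$ by $$a(\boldsymbol{0}w)=\boldsymbol{0}w,\quad a(\boldsymbol{1}w)=\boldsymbol{1}\,b(w),\quad b(\boldsymbol{0}w)=\boldsymbol{1}\,a(w),\quad b(\boldsymbol{1}w)=\boldsymbol{0}w.$$ *)

(* Defs.v *)
From HB Require Import structures.
From mathcomp Require Import all_boot.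
From mathcomp Require Import boolp classical_sets functions cardinality.

Set Implicit Arguments.
Unset Strict Implicit.
Unset Printing Implicit Defensive.

Local Open Scope classical_set_scope.
Local Open Scope group_scope.

Section Subgroups.
Variable gT : groupType.
Implicit Types A G H K M : set gT.

Definition subgroup H : Prop := group_closed [in H].

Definition gen_subgroup A : set gT := smallest subgroup A.

Definition maximal_subgroup M G : Prop :=
  [/\ subgroup M, M `<=` G, M <> G &
      forall K, subgroup K -> M `<=` K -> K `<=` G -> K = M \/ K = G].

Definition left_coset x H : set gT := [set x * h | h in H].

Definition finite_index H G : Prop :=
  finite_set [set left_coset x H | x in G].

End Subgroups.

(* The letters 0 and 1 of X are encoded as [false] and [true]. *)
Definition word := seq bool.

Definition tree_adj (u v : word) : bool :=
  (prefix u v && (size v == (size u).+1)) ||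
  (prefix v u && (size u == (size v).+1)).

(* The inverse is kept as data; it is determined by [tfun], see [tree_aut_inj]. *)
Record tree_aut := TreeAut {
  tfun :> word -> word;
  tinv : word -> word;
  tfunK : cancel tfun tinv;
  tinvK : cancel tinv tfun;
  tfun_root : tfun [::] = [::];
  tfun_adj : {mono tfun : u v / tree_adj u v}
}.

Lemma tree_aut_inj (f g : tree_aut) : tfun f =1 tfun g -> f = g.
Proof.
case: f g => [f f' fK f'K f0 fA] [g g' gK g'K g0 gA] /= /funext fg.
subst g; have fg' : f' = g' by apply/funext => w; rewrite -{1}(g'K w) fK.
subst g'; congr TreeAut; exact: Prop_irrelevance.
Qed.

HB.instance Definition _ := gen_eqMixin tree_aut.
HB.instance Definition _ := gen_choiceMixin tree_aut.

Definition tree_one : tree_aut.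
Proof. by exists id id. Defined.

Definition tree_mul (f g : tree_aut) : tree_aut.
Proof.
exists (tfun f \o tfun g) (tinv g \o tinv f).
- exact: can_comp (tfunK f) (tfunK g).
- exact: can_comp (tinvK g) (tinvK f).
- by rewrite /= !tfun_root.
- by move=> u v /=; rewrite !tfun_adj.
Defined.

Definition tree_inv (f : tree_aut) : tree_aut.
Proof.
exists (tinv f) (tfun f).
- exact: tinvK.
- exact: tfunK.
- by rewrite -{1}(tfun_root f) tfunK.
- by move=> u v; rewrite -(tfun_adj f) !tinvK.
Defined.

Fact tree_mulA : associative tree_mul.
Proof. by move=> f g h; apply: tree_aut_inj. Qed.

Fact tree_mul1 : left_id tree_one tree_mul.
Proof. by move=> f; apply: tree_aut_inj. Qed.

Fact tree_mulr1 : right_id tree_one tree_mul.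
Proof. by move=> f; apply: tree_aut_inj. Qed.

Fact tree_mulVl : left_inverse tree_one tree_inv tree_mul.
Proof. by move=> f; apply: tree_aut_inj => w /=; rewrite tfunK. Qed.

Fact tree_mulVr : right_inverse tree_one tree_inv tree_mul.
Proof. by move=> f; apply: tree_aut_inj => w /=; rewrite tinvK. Qed.

HB.instance Definition _ :=
  isGroup.Build tree_aut tree_mulA tree_mul1 tree_mulr1 tree_mulVl tree_mulVr.

Fixpoint a_fun (w : word) : word :=
  match w with
  | [::] => [::]
  | false :: w' => false :: w'
  | true :: w' => true :: b_fun w'
  end
with b_fun (w : word) : word :=
  match w with
  | [::] => [::]
  | false :: w' => true :: a_fun w'
  | true :: w' => false :: w'
  end.

Fixpoint a_inv (w : word) : word :=
  match w with
  | [::] => [::]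
  | false :: w' => false :: w'
  | true :: w' => true :: b_inv w'
  end
with b_inv (w : word) : word :=
  match w with
  | [::] => [::]
  | true :: w' => false :: a_inv w'
  | false :: w' => true :: w'
  end.

Fact ab_funK : cancel a_fun a_inv /\ cancel b_fun b_inv.
Proof.
suff H w : a_inv (a_fun w) = w /\ b_inv (b_fun w) = w.
  by split=> w; case: (H w).
by elim: w => [|[] w [IHa IHb]] //=; rewrite ?IHa ?IHb.
Qed.

Fact ab_invK : cancel a_inv a_fun /\ cancel b_inv b_fun.
Proof.
suff H w : a_fun (a_inv w) = w /\ b_fun (b_inv w) = w.
  by split=> w; case: (H w).
by elim: w => [|[] w [IHa IHb]] //=; rewrite ?IHa ?IHb.
Qed.

Fact ab_size w : size (a_fun w) = size w /\ size (b_fun w) = size w.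
Proof. by elim: w => [|[] w [IHa IHb]] //=; rewrite ?IHa ?IHb. Qed.

Fact ab_prefix u v :
  prefix (a_fun u) (a_fun v) = prefix u v /\
  prefix (b_fun u) (b_fun v) = prefix u v.
Proof.
elim: u v => [|x u IH] [|y v] /=; rewrite ?prefix0s //; first by case: x.
by have [IHa IHb] := IH v; case: x; case: y; rewrite /= ?IHa ?IHb.
Qed.

Fact a_adj : {mono a_fun : u v / tree_adj u v}.
Proof.
move=> u v; rewrite /tree_adj (ab_size u).1 (ab_size v).1.
by rewrite (ab_prefix u v).1 (ab_prefix v u).1.
Qed.

Fact b_adj : {mono b_fun : u v / tree_adj u v}.
Proof.
move=> u v; rewrite /tree_adj (ab_size u).2 (ab_size v).2.
by rewrite (ab_prefix u v).2 (ab_prefix v u).2.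
Qed.

Definition basilica_a : tree_aut :=
  TreeAut ab_funK.1 ab_invK.1 (erefl : a_fun [::] = [::]) a_adj.

Definition basilica_b : tree_aut :=
  TreeAut ab_funK.2 ab_invK.2 (erefl : b_fun [::] = [::]) b_adj.

Definition basilica : set tree_aut :=
  gen_subgroup [set basilica_a; basilica_b].

(* Main.v *)
Require Import Defs.
From mathcomp Require Import all_boot boolp classical_sets functions cardinality.
From mathcomp Require Import zify.

(* Every nontrivial normal subgroup of B contains a subgroup
   D_j = B'' x ... x B'' (2^j factors, acting below the vertices of level j), and
   B has a series of normal subgroups from B down to D_j with finitely generated
   abelian factors. A maximal subgroup M of infinite index therefore satisfies
   M D_j = B for all j. This property and properness both pass from M to the
   group of sections at the vertex 1 of the stabiliser of 1 in M, because B' is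
   not contained in B''.

   Let w be a word in a and b with exponent sums (i, 1). The section of w^2 at
   the vertex 1 is given by a word of the same length with exponent sums (1, i),
   which is not reduced if w contains b^-1. If w has exponent sums (1, 0), the
   same construction applies to the product of w and its conjugate by ab.
   Starting from (1, 1) one thus reaches a conjugate of ba, hence after
   conjugation some M containing ba. Descending then from an element with
   exponent sums (0, 1), always keeping ba or ab, one reaches b^(a^p), and p then
   decreases in absolute value until p = 0 or p = 1. Together with ba this
   element generates B, contradicting properness. *)

Set Implicit Arguments.
Unset Strict Implicit.
Unset Printing Implicit Defensive.

Local Open Scope classical_set_scope.
Local Open Scope group_scope.

(** * Subgroups, normalisation and derived subgroups of an arbitrary group *)

Section Subgroups.
Variable gT : groupType.
Implicit Types (A G H K L M N : set gT) (x y g : gT).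

Lemma subgroup1 H : subgroup H -> H 1.
Proof. by move=> [H1 _]; exact: (set_mem H1). Qed.

Lemma subgroupF H x y : subgroup H -> H x -> H y -> H (x / y).
Proof. by move=> [_ HF] Hx Hy; apply: (set_mem (HF x y _ _)); apply: mem_set. Qed.

Lemma subgroupV H x : subgroup H -> H x -> H x^-1.
Proof.
by move=> sH Hx; rewrite -div1g; apply: subgroupF => //; apply: subgroup1.
Qed.

Lemma subgroupM H x y : subgroup H -> H x -> H y -> H (x * y).
Proof.
by move=> sH Hx Hy; rewrite -[y]invgK; apply: subgroupF => //; apply: subgroupV.
Qed.

Lemma subgroupJ H x y : subgroup H -> H x -> H y -> H (x ^ y).
Proof.
by move=> sH Hx Hy; apply: subgroupM => //; [apply: subgroupV | apply: subgroupM].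
Qed.

Lemma subgroupR H x y : subgroup H -> H x -> H y -> H [~ x, y].
Proof.
by move=> sH Hx Hy; apply: subgroupM => //; [apply: subgroupV | apply: subgroupJ].
Qed.

Lemma subgroupX H x n : subgroup H -> H x -> H (x ^+ n).
Proof.
move=> sH Hx; elim: n => [|n IHn]; first exact: subgroup1.
by rewrite expgS; apply: subgroupM.
Qed.

Lemma subgroup_intro H :
    H 1 -> (forall x y, H x -> H y -> H (x * y)) ->
  (forall x, H x -> H x^-1) -> subgroup H.
Proof.
move=> H1 HM HV; split=> [|x y Hx Hy]; first exact: mem_set.
by apply/mem_set/HM; [exact: (set_mem Hx) | exact/HV/(set_mem Hy)].
Qed.

Lemma subgroupMl H x y : subgroup H -> H x -> H (x * y) -> H y.
Proof.
by move=> sH Hx Hxy; rewrite -(mulKg x y); apply: subgroupM => //; apply: subgroupV.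
Qed.

Lemma subgroupMr H x y : subgroup H -> H y -> H (x * y) -> H x.
Proof.
by move=> sH Hy Hxy; rewrite -(mulgK y x); apply: subgroupF.
Qed.

Lemma subgroupI H K : subgroup H -> subgroup K -> subgroup (H `&` K).
Proof.
move=> sH sK; apply: subgroup_intro.
- by split; apply: subgroup1.
- by move=> x y [Hx Kx] [Hy Ky]; split; apply: subgroupM.
- by move=> x [Hx Kx]; split; apply: subgroupV.
Qed.

Lemma gen_subgroupP A : subgroup (gen_subgroup A).
Proof.
apply: subgroup_intro.
- by move=> H [sH _]; apply: subgroup1.
- move=> x y gx gy H sAH; have [sH _] := sAH.
  by apply: subgroupM; [| apply: gx | apply: gy].
- move=> x gx H sAH; have [sH _] := sAH.
  by apply: subgroupV => //; apply: gx.
Qed.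

Lemma gen_subgroup_sub A : A `<=` gen_subgroup A.
Proof. exact: sub_gen_smallest. Qed.

Lemma gen_subgroup_min A H : subgroup H -> A `<=` H -> gen_subgroup A `<=` H.
Proof. by move=> sH sAH; apply: smallest_sub. Qed.

Lemma gen_subgroupS A H : A `<=` H -> gen_subgroup A `<=` gen_subgroup H.
Proof.
move=> sAH; apply: gen_subgroup_min; first exact: gen_subgroupP.
exact: subset_trans sAH (@gen_subgroup_sub H).
Qed.

Definition normalised G K : Prop := forall g x, G g -> K x -> K (x ^ g).

(** The elements whose conjugation maps [K] into itself form only a monoid, so inverses of
    generators are checked as well. *)
Lemma normalised_gen A K :
    (forall g x, A g -> K x -> K (x ^ g) /\ K (x ^ g^-1)) ->
  normalised (gen_subgroup A) K.
Proof.
move=> AK; pose S := [set g | forall x, K x -> K (x ^ g) /\ K (x ^ g^-1)].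
suff sAS: gen_subgroup A `<=` S by move=> g x /sAS Sg /Sg[].
apply: gen_subgroup_min => [|g Ag x Kx]; last exact: AK.
apply: subgroup_intro.
- by move=> x; rewrite invg1 conjg1.
- move=> g h Sg Sh x Kx; rewrite invgM !conjgM.
  by split; [case: (Sg x Kx) => /Sh[] | case: (Sh x Kx) => _ /Sg[]].
- by move=> g Sg x Kx; rewrite invgK; have [] := Sg x Kx.
Qed.

Lemma gen_normalised G A :
    (forall g x, G g -> A x -> gen_subgroup A (x ^ g)) ->
  normalised G (gen_subgroup A).
Proof.
move=> GA g x Gg gx; pose S := [set y | gen_subgroup A (y ^ g)].
have sA := gen_subgroupP A.
suff sAS : gen_subgroup A `<=` S by apply: sAS.
apply: gen_subgroup_min => [|y Ay]; last exact: GA.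
apply: subgroup_intro; rewrite /S /=.
- by rewrite conj1g; apply: subgroup1 sA.
- by move=> y z Sy Sz; rewrite conjMg; apply: subgroupM sA _ _.
- by move=> y Sy; rewrite conjVg; apply: subgroupV sA _.
Qed.

Lemma gen_normalised_gen S A :
    (forall g x, S g -> A x ->
       gen_subgroup A (x ^ g) /\ gen_subgroup A (x ^ g^-1)) ->
  normalised (gen_subgroup S) (gen_subgroup A).
Proof.
move=> SA; apply: normalised_gen => g x Sg Ax; split.
  apply: (@gen_normalised [set g]) => // _ y -> Ay.
  by have [] := SA g y Sg Ay.
apply: (@gen_normalised [set g^-1]) => // _ y -> Ay.
by have [] := SA g y Sg Ay.
Qed.

Definition derived G : set gT := gen_subgroup [set [~ x, y] | x in G & y in G].

Lemma derived_subgroup G : subgroup (derived G).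
Proof. exact: gen_subgroupP. Qed.

Lemma derivedR G x y : G x -> G y -> derived G [~ x, y].
Proof. by move=> Gx Gy; apply: gen_subgroup_sub; exists x => //; exists y. Qed.

Lemma derived_min G H : subgroup H ->
  (forall x y, G x -> G y -> H [~ x, y]) -> derived G `<=` H.
Proof.
by move=> sH RH; apply: gen_subgroup_min => // _ [x Gx] [y Gy <-]; apply: RH.
Qed.

Lemma derived_sub G : subgroup G -> derived G `<=` G.
Proof. by move=> sG; apply: derived_min => // x y Gx Gy; apply: subgroupR. Qed.

Lemma derived_normalised G H : normalised G H -> normalised G (derived H).
Proof.
move=> nH; apply: gen_normalised => g _ Gg [x Hx] [y Hy <-]; rewrite conjRg.
by apply: derivedR; apply: nH.
Qed.

(** Modulo the normal subgroup [L] the identity [[x z, y] = [x, y]^z [z, y]] extends triviality of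
    commutators from generators to products. It is applied once in each argument, exchanging them by
    inversion. *)
Lemma derived_gen_min A L : subgroup L -> normalised (gen_subgroup A) L ->
    (forall x y, A x -> A y -> L [~ x, y]) ->
  derived (gen_subgroup A) `<=` L.
Proof.
move=> sL nL AL; have sA := gen_subgroupP A.
have step S y : gen_subgroup A y -> (forall x, S x -> A x) ->
    (forall x, S x -> L [~ x, y]) -> forall x, gen_subgroup S x -> L [~ x, y].
  move=> Ay SA SL.
  have sub: gen_subgroup S `<=` [set x | gen_subgroup A x /\ L [~ x, y]].
    apply: gen_subgroup_min => [|x Sx]; last first.
      by split; [exact: (gen_subgroup_sub (SA x Sx)) | apply: SL].
    apply: subgroup_intro => /=.
    - by rewrite comm1g; split; [apply: subgroup1 sA | apply: subgroup1 sL].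
    - move=> x z [Ax Lx] [Az Lz]; split; first exact: subgroupM sA _ _.
      have -> : [~ x * z, y] = [~ x, y] ^ z * [~ z, y].
        by rewrite /commg /conjg !gnorm.
      by apply: subgroupM => //; apply: nL.
    - move=> x [Ax Lx]; split; first exact: subgroupV sA _.
      have -> : [~ x^-1, y] = ([~ x, y]^-1) ^ x^-1.
        by rewrite /commg /conjg !gnorm.
      by apply: nL; [apply: subgroupV sA _ | apply: subgroupV].
  by move=> x /sub[].
apply: derived_min => // x y Ax Ay; apply: (step A) => // z Az.
rewrite -invgR; apply: (subgroupV sL).
by apply: (step A) Ay => // [|t At]; [apply: gen_subgroup_sub | apply: AL].
Qed.

(** [R] is a subgroup of the direct square, so commutators of related elements are related. It
    serves to find partners in [B''] for elements of [B'']. *)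
Lemma derived_rel (R : gT -> gT -> Prop) G H :
    R 1 1 -> (forall x x' y y', R x y -> R x' y' -> R (x * x') (y * y')) ->
    (forall x y, R x y -> R x^-1 y^-1) ->
    (forall x, G x -> exists2 y, H y & R x y) ->
  forall x, derived G x -> exists2 y, derived H y & R x y.
Proof.
move=> R1 RM RV GH; have sH := derived_subgroup H.
apply: derived_min => [|x x' /GH[y Hy Rxy] /GH[y' Hy' Rxy']].
  apply: subgroup_intro.
  - by exists 1 => //; apply: subgroup1 sH.
  - move=> x x' [y Hy Rxy] [y' Hy' Rxy'].
    by exists (y * y'); [apply: subgroupM sH _ _ | apply: RM].
  - by move=> x [y Hy Rxy]; exists y^-1; [apply: subgroupV sH _ | apply: RV].
exists [~ y, y']; first exact: derivedR.
exact: RM (RV _ _ Rxy) (RM _ _ _ _ (RV _ _ Rxy') (RM _ _ _ _ Rxy Rxy')).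
Qed.

End Subgroups.

(** * Finitely generated abelian factors and maximal subgroups *)

Section AbelianQuotient.
Variable gT : groupType.
Implicit Types (G H K M N : set gT) (x y u v : gT) (xs : seq gT).

Definition abelian_mod N H : Prop :=
  [/\ subgroup N, subgroup H, H `<=` N & derived N `<=` H].

(** Equality in [N / H], used in place of forming the quotient group. *)
Definition eqm H u v : Prop := H (u^-1 * v).

Lemma eqm_refl H u : subgroup H -> eqm H u u.
Proof. by move=> sH; rewrite /eqm mulVg; apply: subgroup1. Qed.

Lemma eqm_sym H u v : subgroup H -> eqm H u v -> eqm H v u.
Proof.
by move=> sH /(subgroupV sH); rewrite /eqm invgM invgK.
Qed.

Lemma eqm_trans H u v w : subgroup H -> eqm H u v -> eqm H v w -> eqm H u w.
Proof.
by move=> sH /(subgroupM sH) Huv /Huv; rewrite /eqm -mulgA mulVKg.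
Qed.

Lemma eqm_mem H u v : subgroup H -> eqm H u v -> H v -> H u.
Proof.
move=> sH Huv Hv; rewrite -[u]invgK; apply: (subgroupV sH).
exact: (subgroupMr sH Hv Huv).
Qed.

Lemma abelian_modJ N H : abelian_mod N H -> normalised N H.
Proof.
case=> sN sH HN dN g x Ng Hx; rewrite -(mulVKg x (x ^ g)).
by apply: (subgroupM sH) => //; apply: dN; apply: derivedR => //; apply: HN.
Qed.

Lemma eqmM N H u u' v v' : abelian_mod N H -> N u' ->
  eqm H u v -> eqm H u' v' -> eqm H (u * u') (v * v').
Proof.
move=> aNH Nu' uv uv'; have [_ sH _ _] := aNH.
have -> : eqm H (u * u') (v * v') = H ((u^-1 * v) ^ u' * (u'^-1 * v')).
  by rewrite /eqm /conjg !gnorm.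
by apply: (subgroupM sH) => //; apply: (abelian_modJ aNH).
Qed.

Lemma eqmC N H u v : abelian_mod N H -> N u -> N v -> eqm H (u * v) (v * u).
Proof.
case=> _ _ _ dN Nu Nv; rewrite /eqm.
have -> : (u * v)^-1 * (v * u) = [~ v, u] by rewrite /commg /conjg !gnorm.
by apply: dN; apply: derivedR.
Qed.

Lemma eqmV N H u v : abelian_mod N H -> N u ->
  eqm H u v -> eqm H u^-1 v^-1.
Proof.
move=> aNH Nu uv; have [sN sH _ _] := aNH.
have -> : eqm H u^-1 v^-1 = H ((u^-1 * v)^-1 ^ u^-1).
  by rewrite /eqm /conjg !gnorm.
by apply: (abelian_modJ aNH); apply: subgroupV.
Qed.

Lemma eqmX N H u v n : abelian_mod N H -> N u ->
  eqm H u v -> eqm H (u ^+ n) (v ^+ n).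
Proof.
move=> aNH Nu uv; have [sN sH _ _] := aNH.
elim: n => [|n IHn]; first exact: eqm_refl.
by rewrite !expgS; apply: (eqmM aNH) => //; apply: subgroupX.
Qed.

Lemma eqmMn N H u v n : abelian_mod N H -> N u -> N v ->
  eqm H ((u * v) ^+ n) (u ^+ n * v ^+ n).
Proof.
move=> aNH Nu Nv; have [sN sH _ _] := aNH.
elim: n => [|n IHn]; first by rewrite !expg0 mul1g; apply: eqm_refl.
have NX w : N w -> N (w ^+ n) by apply: subgroupX.
rewrite !expgS; apply: (@eqm_trans _ _ (u * v * (u ^+ n * v ^+ n))) => //.
  by apply: (eqmM aNH _ (eqm_refl _ sH) IHn); apply: NX; apply: subgroupM.
rewrite -!mulgA; apply: (eqmM aNH _ (eqm_refl _ sH) _).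
  by do !apply: (subgroupM sN) => //; apply: NX.
rewrite !mulgA; apply: (eqmM aNH _ _ (eqm_refl _ sH)); first exact: NX.
by apply: (eqmC aNH) => //; apply: NX.
Qed.

Lemma abelian_mod_gen N H A : abelian_mod N H -> A `<=` N ->
  abelian_mod N (gen_subgroup (H `|` A)).
Proof.
case=> sN sH HN dN AN; split=> //; first exact: gen_subgroupP.
  by apply: gen_subgroup_min => // x [/HN|/AN].
by move=> x /dN Hx; apply: gen_subgroup_sub; left.
Qed.

Lemma gen_cons H x xs : gen_subgroup (H `|` [set` x :: xs]) `<=`
  gen_subgroup (gen_subgroup (H `|` [set x]) `|` [set` xs]).
Proof.
apply: gen_subgroup_min => [|y]; first exact: gen_subgroupP.
case=> [Hy|/=]; first by apply: gen_subgroup_sub; left; apply: gen_subgroup_sub; left.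
rewrite inE => /orP[/eqP->|xs_y]; apply: gen_subgroup_sub; last by right.
by left; apply: gen_subgroup_sub; right.
Qed.

Lemma gen_cyclic_mod N H x y : abelian_mod N H -> N x ->
    gen_subgroup (H `|` [set x]) y ->
  N y /\ exists m n, eqm H (y * x ^+ n) (x ^+ m).
Proof.
move=> aNH Nx; have [sN sH HN _] := aNH.
have NX n : N (x ^+ n) by apply: subgroupX.
move: y; apply: gen_subgroup_min => [|y].
  apply: subgroup_intro.
  - by split; [apply: subgroup1 | exists 0, 0; rewrite mul1g; apply: eqm_refl].
  - move=> y y' [Ny [m [n yx]]] [Ny' [m' [n' yx']]]; split; first exact: subgroupM.
    exists (m + m')%N, (n + n')%N; rewrite addnC !expgnDr.
    apply: (@eqm_trans _ _ (y * x ^+ n * x ^+ m')) => //.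
      rewrite -!mulgA; apply: (eqmM aNH _ (eqm_refl _ sH) _).
        by do !apply: (subgroupM sN) => //.
      apply: (@eqm_trans _ _ (x ^+ m' * x ^+ n)) => //.
        rewrite mulgA; apply: (eqmM aNH _ _ (eqm_refl _ sH)) => //.
      exact: (eqmC aNH).
    by apply: (eqmM aNH _ _ (eqm_refl _ sH)).
  - move=> y [Ny [m [n yx]]]; split; first exact: subgroupV.
    exists n, m; rewrite -(mulKg y (x ^+ n)).
    apply: (eqmM aNH _ (eqm_refl _ sH) _) => //; exact: eqm_sym.
case=> [Hy|->]; split=> //; first exact: HN.
  exists 0, 0; rewrite mulg1; apply: eqm_sym => //.
  by rewrite /eqm invg1 mul1g.
by exists 1%N, 0; rewrite mulg1; apply: eqm_refl.
Qed.

(** A finitely generated divisible abelian group is trivial. By induction [N] is generated by [H]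
    and one element [x], and a cyclic divisible group is trivial. *)
Lemma fg_divisible_mod N H xs : abelian_mod N H -> [set` xs] `<=` N ->
    N `<=` gen_subgroup (H `|` [set` xs]) ->
    (forall x n, N x -> 0 < n -> exists2 y, N y & eqm H x (y ^+ n)) ->
  N `<=` H.
Proof.
elim: xs H => [|x xs IHxs] H aNH xsN Ngen divN; have [sN sH HN dN] := aNH.
  apply: (subset_trans Ngen); apply: gen_subgroup_min => // y [//|/=].
  by rewrite in_nil.
have Nx : N x by apply: xsN; rewrite /= mem_head.
have xsN' : [set` xs] `<=` N by move=> y xs_y; apply: xsN; rewrite /= inE orbC [y \in _]xs_y.
have aNH1 : abelian_mod N (gen_subgroup (H `|` [set x])).
  by apply: abelian_mod_gen => // _ ->.
have HH1 : H `<=` gen_subgroup (H `|` [set x]).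
  by move=> y Hy; apply: gen_subgroup_sub; left.
have NH1 : N `<=` gen_subgroup (H `|` [set x]).
  apply: IHxs => // [|y n Ny n_gt0].
    by apply: (subset_trans Ngen); apply: gen_cons.
  by have [z Nz yz] := divN y n Ny n_gt0; exists z => //; apply: HH1.
have NX y n : N y -> N (y ^+ n) by apply: subgroupX.
suff Hx : H x.
  apply: (subset_trans NH1); apply: gen_subgroup_min => // y [//|->//].
(* Writing [x] as a square modulo [H] shows that an odd power of [x] is in [H]. *)
have [k Hxk k_gt0] : exists2 k, H (x ^+ k) & 0 < k.
  have [y Ny xy] := divN x 2 Nx isT.
  have [_ [m [n yx]]] := gen_cyclic_mod aNH Nx (NH1 y Ny).
  have xmn : eqm H (x ^+ (n * 2).+1) (x ^+ (m * 2)).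
    rewrite expgS !expgnA.
    apply: (@eqm_trans _ _ (y ^+ 2 * x ^+ n ^+ 2)) => //.
      by apply: (eqmM aNH _ xy (eqm_refl _ sH)); rewrite -expgnA; apply: NX.
    apply: (@eqm_trans _ _ ((y * x ^+ n) ^+ 2)) => //.
      by apply: (eqm_sym sH (eqmMn 2 aNH Ny _)); apply: NX.
    by apply: (eqmX _ aNH _ yx); apply: subgroupM => //; apply: NX.
  have [le_mn|lt_nm] := leqP (m * 2) (n * 2).
    exists ((n * 2).+1 - m * 2); last by rewrite subn_gt0 ltnS.
    move: (eqm_sym sH xmn); rewrite /eqm -{1}(subnKC (leqW le_mn)) expgnDr.
    by rewrite mulKg.
  have lt_nm' : (n * 2).+1 < m * 2.
    by rewrite ltn_neqAle lt_nm andbT; apply/eqP => /(congr1 odd); rewrite /= !oddM !andbF.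
  exists (m * 2 - (n * 2).+1); last by rewrite subn_gt0.
  by move: xmn; rewrite /eqm -{1}(subnKC (ltnW lt_nm')) expgnDr mulKg.
(* Now [x] has order dividing [k] modulo [H] and is the [k]-th power of some [y], itself a power of
   [x]; hence [x] is trivial modulo [H]. *)
have [y Ny xy] := divN x k Nx k_gt0.
have [_ [m [n yx]]] := gen_cyclic_mod aNH Nx (NH1 y Ny).
have HX i : H (x ^+ i ^+ k) by rewrite expgnAC; apply: subgroupX.
apply: (eqm_mem sH xy); apply: (subgroupMr sH (HX n)).
have yxk : eqm H (y ^+ k * x ^+ n ^+ k) (x ^+ m ^+ k).
  apply: (@eqm_trans _ _ ((y * x ^+ n) ^+ k)) => //.
    by apply: eqm_sym => //; apply: (eqmMn _ aNH) => //; apply: NX.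
  by apply: (eqmX _ aNH _ yx); apply: subgroupM => //; apply: NX.
exact: (eqm_mem sH yxk (HX m)).
Qed.

(** A finitely generated abelian group of finite exponent is finite: adding one generator [x]
    multiplies the set of representatives by the powers [x ^+ i] with [i < n]. *)
Lemma fg_exponent_mod N H xs n : abelian_mod N H -> [set` xs] `<=` N ->
    N `<=` gen_subgroup (H `|` [set` xs]) -> 0 < n ->
    (forall x, N x -> H (x ^+ n)) ->
  exists2 F, finite_set F & N `<=` [set x * y | x in F & y in H].
Proof.
elim: xs H => [|x xs IHxs] H aNH xsN Ngen n_gt0 expN; have [sN sH HN dN] := aNH.
  exists [set 1] => // y /Ngen Hy; exists 1 => //; exists y; last by rewrite mul1g.
  by move: y Hy; apply: gen_subgroup_min => // y [//|/=]; rewrite in_nil.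
have Nx : N x by apply: xsN; rewrite /= mem_head.
have xsN' : [set` xs] `<=` N by move=> y xs_y; apply: xsN; rewrite /= inE orbC [y \in _]xs_y.
have aNH1 : abelian_mod N (gen_subgroup (H `|` [set x])).
  by apply: abelian_mod_gen => // _ ->.
have [||F finF NF] := IHxs _ aNH1 xsN' _ n_gt0.
- by apply: (subset_trans Ngen); apply: gen_cons.
- by move=> y Ny; apply: gen_subgroup_sub; left; apply: expN.
exists [set f * x ^+ i | f in F & i in `I_n]; first exact: finite_image2.
move=> y /NF[f Ff [z H1z <-]].
have [Nz [i [j zx]]] := gen_cyclic_mod aNH Nx H1z.
(* [k] is congruent to [i - j] modulo [n], which avoids a negative exponent. *)
pose k := (i + j * n.-1)%N.
have zk : eqm H z (x ^+ (k %% n)).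
  have NX l : N (x ^+ l) by apply: subgroupX.
  have Hxn l : H (x ^+ (l * n)) by rewrite mulnC expgnA; apply: subgroupX => //; apply: expN.
  apply: (@eqm_trans _ _ (z * x ^+ (j * n))) => //.
    by rewrite /eqm mulKg.
  apply: (@eqm_trans _ _ (x ^+ k)) => //.
    have -> : (j * n = j + j * n.-1)%N by rewrite -mulnS prednK.
    rewrite /k !expgnDr mulgA.
    by apply: (eqmM aNH _ zx (eqm_refl _ sH)).
  rewrite [k in x ^+ k](divn_eq k n) expgnDr -[x ^+ (k %% n)]mul1g.
  rewrite mulgA mulg1; apply: (eqmM aNH _ _ (eqm_refl _ sH)) => //.
  rewrite /eqm mulg1; exact: subgroupV.
exists (f * x ^+ (k %% n)); first by exists f => //; exists (k %% n) => //=; rewrite ltn_mod.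
by exists ((x ^+ (k %% n))^-1 * z); [apply: eqm_sym | rewrite -mulgA mulVKg].
Qed.

Definition fg_mod N H : Prop :=
  exists2 xs : seq gT, [set` xs] `<=` N & N `<=` gen_subgroup (H `|` [set` xs]).

(* If neither alternative holds then [M N = G], so [H = M `&` N] is normal in
   [G]; each [N^n H] is then normal too, hence lies in [M] or is all of [N].
   The former gives [N / H] finite, the latter for all [n] gives [N = H]. *)
Lemma maximal_abelian_step M G K N : subgroup G -> maximal_subgroup M G ->
    normalised G N -> N `<=` G -> abelian_mod N K -> fg_mod N K -> K `<=` M ->
  N `<=` M \/ finite_index M G.
Proof.
move=> sG [sM MG _ maxM] nN NG aNK [xs xsN Ngen] KM; have [sN sK KN dN] := aNK.
have [NM|nNM] := pselect (N `<=` M); [by left | right].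
(* The set [Q] is the product [P M]. It contains [M] and [P], and [P] is not inside [M], so
   maximality gives [Q = G]. *)
have prod P : subgroup P -> P `<=` N -> normalised M P -> ~ P `<=` M ->
    forall g, G g -> exists2 p, P p & M (p * g).
  move=> sP PN nP nPM; pose Q := [set g | exists2 p, P p & M (p * g)].
  have sQ : subgroup Q.
    apply: subgroup_intro.
    - by exists 1; rewrite ?mul1g; apply: subgroup1.
    - move=> g h [p Pp Mg] [q Pq Mh]; exists (q ^ (p * g)^-1 * p).
        by apply: (subgroupM sP) => //; apply: nP => //; apply: subgroupV.
      have -> : q ^ (p * g)^-1 * p * (g * h) = p * g * (q * h).
        by rewrite /conjg !gnorm.
      exact: subgroupM.
    - move=> g [p Pp Mg]; exists (p^-1 ^ (p * g)).
        by apply: nP => //; apply: subgroupV.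
      have -> : p^-1 ^ (p * g) * g^-1 = (p * g)^-1 by rewrite /conjg !gnorm.
      exact: subgroupV.
  have PQ : P `<=` Q.
    move=> p Pp; exists p^-1; first exact: subgroupV.
    by rewrite mulVg; apply: subgroup1.
  have [|//|QM|QG] := maxM Q sQ.
  - by move=> g Mg; exists 1; rewrite ?mul1g //; apply: subgroup1.
  - move=> g [p Pp Mg]; apply: (subgroupMl sG (NG _ (PN _ Pp))).
    exact: MG.
  - by case: nPM; rewrite -QM.
  - by move=> g Gg; have : Q g by rewrite QG.
pose H := M `&` N; have sH : subgroup H by apply: subgroupI.
have KH : K `<=` H by move=> x Kx; split; [apply: KM | apply: KN].
have aNH : abelian_mod N H by split=> // [x []//|]; apply: (subset_trans dN KH).
have nMN : normalised M N by move=> g x /MG; apply: nN.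
have nMH : normalised M H.
  by move=> g x Mg [Mx Nx]; split; [apply: subgroupJ | apply: nMN].
have prodN := prod N sN (@subset_refl _ _) nMN nNM.
have Ngen' : N `<=` gen_subgroup (H `|` [set` xs]).
  by apply: (subset_trans Ngen); apply: gen_subgroupS => x [/KH|]; [left|right].
have [expN|divN] := pselect (exists2 n, 0 < n & forall x, N x -> M (x ^+ n)).
  have [n n_gt0 NnM] := expN.
  have [x Nx|F finF NF] := fg_exponent_mod aNH xsN Ngen' n_gt0.
    by split; [apply: NnM | apply: subgroupX].
  (* Each [g] is [p^-1 (p g)] with [p g] in [M] and [p^-1] in [f H], so its coset is that of some
     [f] in [F]. *)
  refine (sub_finite_set _ (finite_image (fun x => left_coset x M) finF)).
  move=> _ [g Gg <-].
  have [p Np Mpg] := prodN g Gg.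
  have [f Ff [h [Mh Nh] fh]] := NF _ (subgroupV sN Np).
  exists f => //; have Mgf : M (f^-1 * g).
    rewrite -[g](mulKg p) -fh !mulgA mulVg mul1g -mulgA; exact: subgroupM.
  apply/seteqP; split=> _ [m Mm <-].
    exists (g^-1 * f * m); last by rewrite -!mulgA mulVKg.
    apply: (subgroupM sM) => //; rewrite -[_ * f]invgK invgM invgK.
    exact: subgroupV.
  by exists (f^-1 * g * m); [apply: subgroupM | rewrite -!mulgA mulVKg].
suff NH : N `<=` H by case: nNM => x /NH[].
apply: (fg_divisible_mod aNH xsN Ngen' _) => x n Nx n_gt0.
(* This is [N^n H]. It is not inside [M] since no power map sends [N] into [M], so [x] is a product
   of an element of [P] and one of [M]; the latter lies in [N], hence in [H]. *)
pose P := [set z | N z /\ exists2 y, N y & eqm H z (y ^+ n)].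
have nHX y k : N y -> N (y ^+ k) by apply: subgroupX.
have sP : subgroup P.
  apply: subgroup_intro.
  - split; first exact: subgroup1.
    exists 1; first exact: subgroup1.
    by rewrite expg1n; apply: eqm_refl.
  - move=> z z' [Nz [y Ny zy]] [Nz' [y' Ny' zy']]; split; first exact: subgroupM.
    exists (y * y'); first exact: subgroupM.
    apply: (@eqm_trans _ _ (y ^+ n * y' ^+ n)) => //.
      exact: (eqmM aNH).
    by apply: eqm_sym => //; apply: (eqmMn _ aNH).
  - move=> z [Nz [y Ny zy]]; split; first exact: subgroupV.
    exists y^-1; first exact: subgroupV.
    by rewrite expVgn; apply: (eqmV aNH).
have [|||p [Np [y Ny py]] Mpx] := prod P sP _ _ _ x (NG x Nx).
- by move=> z [].
- move=> g z Mg [Nz [y Ny zy]]; split; first exact: nMN.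
  exists (y ^ g); first exact: nMN.
  rewrite -conjXg /eqm -conjVg -conjMg; exact: nMH.
- move=> PM; case: divN; exists n => // y Ny; apply: PM; split; first exact: nHX.
  by exists y => //; apply: eqm_refl.
exists y^-1; first exact: subgroupV.
have Hpx : H (p * x) by split=> //; apply: subgroupM.
rewrite expVgn; apply: (@eqm_trans _ _ p^-1) => //; last exact: (eqmV aNH).
by apply: eqm_sym => //; rewrite /eqm invgK.
Qed.

End AbelianQuotient.

(** * Pairs of automorphisms and the sections of B *)

Definition pair_fun (f g : word -> word) (w : word) : word :=
  match w with
  | [::] => [::]
  | false :: w' => false :: f w'
  | true :: w' => true :: g w'
  end.

Lemma pair_funK f f' g g' : cancel f f' -> cancel g g' ->
  cancel (pair_fun f g) (pair_fun f' g').
Proof. by move=> fK gK [|[] w] //=; rewrite ?fK ?gK. Qed.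

(** Needed for edges at the root: the root is adjacent to [x :: w] exactly when [w] is empty. *)
Lemma tree_aut_size0 (f : tree_aut) w : (size (f w) == 0) = (size w == 0).
Proof.
rewrite !size_eq0 -[in RHS](inj_eq (can_inj (tfunK f))).
by rewrite tfun_root.
Qed.

Lemma pair_fun_adj (f g : tree_aut) :
  {mono pair_fun f g : u v / tree_adj u v}.
Proof.
have adjE x u v : tree_adj (x :: u) (x :: v) = tree_adj u v.
  by rewrite /tree_adj /= eqxx !eqSS.
by move=> [|[] u] [|[] v] //=; rewrite ?adjE ?tfun_adj //;
  rewrite /tree_adj /= ?andbF ?eqSS ?tree_aut_size0.
Qed.

Definition tree_pair (f g : tree_aut) : tree_aut :=
  TreeAut (pair_funK (tfunK f) (tfunK g)) (pair_funK (tinvK f) (tinvK g))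
    (erefl : pair_fun f g [::] = [::]) (@pair_fun_adj f g).

Local Notation a := basilica_a.
Local Notation b := basilica_b.
Local Notation B := basilica.

Lemma tree_pairM f g f' g' :
  tree_pair f g * tree_pair f' g' = tree_pair (f * f') (g * g').
Proof. by apply: tree_aut_inj => -[|[] w]. Qed.

Lemma tree_pairV f g : (tree_pair f g)^-1 = tree_pair f^-1 g^-1.
Proof. by apply: tree_aut_inj => -[|[] w]. Qed.

Lemma tree_pair1 : tree_pair 1 1 = 1.
Proof. by apply: tree_aut_inj => -[|[] w]. Qed.

Lemma tree_pairJ f g f' g' :
  tree_pair f g ^ tree_pair f' g' = tree_pair (f ^ f') (g ^ g').
Proof. by rewrite /conjg tree_pairV !tree_pairM. Qed.

Lemma tree_pairR f g f' g' :
  [~ tree_pair f g, tree_pair f' g'] = tree_pair [~ f, f'] [~ g, g'].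
Proof. by rewrite /commg tree_pairJ tree_pairV !tree_pairM. Qed.

Lemma tree_pairX f g n : tree_pair f g ^+ n = tree_pair (f ^+ n) (g ^+ n).
Proof.
elim: n => [|n IHn]; first by rewrite !expg0 tree_pair1.
by rewrite !expgS IHn tree_pairM.
Qed.

Lemma tree_pair_inj f g f' g' :
  tree_pair f g = tree_pair f' g' -> f = f' /\ g = g'.
Proof.
move=> /(congr1 tfun) fg; split; apply: tree_aut_inj => w.
  by have := congr1 (fun h => h (false :: w)) fg => -[].
by have := congr1 (fun h => h (true :: w)) fg => -[].
Qed.

Lemma basilica_aE : a = tree_pair 1 b.
Proof. by apply: tree_aut_inj => -[|[] w]. Qed.

Lemma basilica_bb : b * b = tree_pair a a.
Proof. by apply: tree_aut_inj => -[|[] w]. Qed.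

Lemma tree_pairJb x y : tree_pair x y ^ b = tree_pair (y ^ a) x.
Proof. by apply: tree_aut_inj => -[|[] w]. Qed.

Lemma tree_pairJbV x y : tree_pair x y ^ b^-1 = tree_pair y (x ^ a^-1).
Proof. by apply: tree_aut_inj => -[|[] w]. Qed.

Lemma tree_pair_bN x y x' y' : tree_pair x y <> tree_pair x' y' * b.
Proof. by move/(congr1 (fun f : tree_aut => f [:: true])). Qed.

Lemma basilica_subgroup : subgroup B.
Proof. exact: gen_subgroupP. Qed.

Lemma basilica_a_in : B a.
Proof. by apply: gen_subgroup_sub; left. Qed.

Lemma basilica_b_in : B b.
Proof. by apply: gen_subgroup_sub; right. Qed.

Local Notation sB := basilica_subgroup.
Local Notation Ba := basilica_a_in.
Local Notation Bb := basilica_b_in.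

Lemma basilica_min H : subgroup H -> H a -> H b -> B `<=` H.
Proof. by move=> sH Ha Hb; apply: gen_subgroup_min => // _ [->|->]. Qed.

(** Self-similarity of [B]. Elements of this form are closed under products and inverses: [b] is
    moved to the right by conjugation, and [b * b] is the pair [(a, a)]. *)
Lemma basilica_section g : B g -> exists x y,
  [/\ B x, B y & g = tree_pair x y \/ g = tree_pair x y * b].
Proof.
move: g; pose P (g : tree_aut) x y := [/\ B x, B y & g = tree_pair x y].
suff sub : B `<=` [set g | exists x y, P g x y \/ P (g / b) x y].
  move=> g /sub[x [y [[Bx By gE]|[Bx By gE]]]]; exists x, y; split=> //; first by left.
  by right; rewrite -gE mulgVK.
have BM x y : B x -> B y -> B (x * y) by apply: (subgroupM sB).
have BV x : B x -> B x^-1 by apply: (subgroupV sB).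
have BJ x y : B x -> B y -> B (x ^ y) by apply: (subgroupJ sB).
have [Ba Bb] := (Ba, Bb); have B1 := subgroup1 sB.
have PM g h x y x' y' : P g x y -> P h x' y' -> P (g * h) (x * x') (y * y').
  by move=> [Bx By ->] [Bx' By' ->]; split; rewrite ?tree_pairM //; apply: BM.
have PJ g x y : P g x y -> P (g ^ b^-1) y (x ^ a^-1).
  by move=> [Bx By ->]; rewrite tree_pairJbV; split=> //; apply: BJ => //; apply: BV.
have PJ' g x y : P g x y -> P (g ^ b) (y ^ a) x.
  by move=> [Bx By ->]; rewrite tree_pairJb; split=> //; apply: BJ.
have PV g x y : P g x y -> P g^-1 x^-1 y^-1.
  by move=> [Bx By ->]; rewrite tree_pairV; split=> //; apply: BV.
have Pbb : P (b * b) a a by rewrite basilica_bb.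
apply: basilica_min; last first.
- by exists 1, 1; right; rewrite mulgV; split; rewrite ?tree_pair1.
- by exists 1, b; left; rewrite basilica_aE; split.
apply: subgroup_intro.
- by exists 1, 1; left; split; rewrite ?tree_pair1.
- move=> g h [x [y Pg]] [x' [y' Ph]]; case: Pg Ph => Pg [] Ph.
  + by exists (x * x'), (y * y'); left; apply: PM.
  + by exists (x * x'), (y * y'); right; rewrite -mulgA; apply: PM.
  + exists (x * y'), (y * (x' ^ a^-1)); right.
    have -> : g * h / b = (g / b) * h ^ b^-1 by rewrite /conjg !gnorm.
    exact: (PM _ _ _ _ _ _ Pg (PJ _ _ _ Ph)).
  + exists (x * y' * a), (y * (x' ^ a^-1) * a); left.
    have -> : g * h = (g / b) * (h / b) ^ b^-1 * (b * b).
      by rewrite /conjg !gnorm.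
    by apply: (PM _ _ _ _ _ _ _ Pbb); apply: (PM _ _ _ _ _ _ Pg (PJ _ _ _ Ph)).
- move=> g [x [y [Pg|Pg]]]; first by exists x^-1, y^-1; left; apply: PV.
  exists (y^-1 ^ a * a^-1), (x^-1 * a^-1); right.
  have -> : g^-1 / b = (g / b)^-1 ^ b * (b * b)^-1 by rewrite /conjg !gnorm.
  exact: (PM _ _ _ _ _ _ (PJ' _ _ _ (PV _ _ _ Pg)) (PV _ _ _ Pbb)).
Qed.

(** * Groups of sections, rigid stabilisers and direct squares *)

Lemma basilica_pair_in x y : B (tree_pair x y) -> B x /\ B y.
Proof.
move=> /basilica_section[x' [y' [Bx' By' [/tree_pair_inj[-> ->]//|]]]].
by move/tree_pair_bN.
Qed.

(** The sections at the vertex 1 of the stabiliser of that vertex in [M]. *)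
Definition sections (M : set tree_aut) : set tree_aut :=
  [set y | exists x, M (tree_pair x y)].

Definition sections0 (M : set tree_aut) : set tree_aut :=
  [set x | exists y, M (tree_pair x y)].

Lemma sections_subgroup M : subgroup M -> subgroup (sections M).
Proof.
move=> sM; apply: subgroup_intro.
- by exists 1; rewrite tree_pair1; apply: subgroup1.
- move=> y y' [x My] [x' My']; exists (x * x'); rewrite -tree_pairM.
  exact: subgroupM.
- by move=> y [x My]; exists x^-1; rewrite -tree_pairV; apply: subgroupV.
Qed.

Lemma sections0_subgroup M : subgroup M -> subgroup (sections0 M).
Proof.
move=> sM; apply: subgroup_intro.
- by exists 1; rewrite tree_pair1; apply: subgroup1.
- move=> x x' [y My] [y' My']; exists (y * y'); rewrite -tree_pairM.
  exact: subgroupM.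
- by move=> x [y My]; exists y^-1; rewrite -tree_pairV; apply: subgroupV.
Qed.

Lemma basilica_pair_b1 : B (tree_pair b 1).
Proof.
have -> : tree_pair b 1 = a ^ b^-1 by rewrite basilica_aE tree_pairJbV conj1g.
by apply: (subgroupJ sB Ba); apply: (subgroupV sB Bb).
Qed.

(** [B] is self-replicating: [a] is a section of [b * b = (a, a)] and [b] one of [a = (1, b)]. *)
Lemma basilica_sections : B `<=` sections B.
Proof.
apply: basilica_min; first exact: (sections_subgroup sB).
- by exists a; rewrite -basilica_bb; apply: (subgroupM sB Bb Bb).
- by exists 1; rewrite -basilica_aE; apply: Ba.
Qed.

Lemma basilica_sections0 : B `<=` sections0 B.
Proof.
apply: basilica_min; first exact: (sections0_subgroup sB).
- by exists a; rewrite -basilica_bb; apply: (subgroupM sB Bb Bb).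
- by exists 1; apply: basilica_pair_b1.
Qed.

(** The rigid stabiliser of the vertex 0 in [K], read as a group acting on the whole tree. *)
Definition rist0 (K : set tree_aut) : set tree_aut :=
  [set x | K (tree_pair x 1)].

Lemma rist0_subgroup K : subgroup K -> subgroup (rist0 K).
Proof.
move=> sK; apply: subgroup_intro; rewrite /rist0 /=.
- by rewrite tree_pair1; apply: subgroup1.
- move=> x y Kx Ky; rewrite -[1]mulg1 -tree_pairM; exact: subgroupM.
- by move=> x Kx; rewrite -[1]invg1 -tree_pairV; apply: subgroupV.
Qed.

(** As [B] is self-replicating, every [g] in [B] is the first coordinate of an element of [B], and
    conjugating [(x, 1)] by that element conjugates [x] by [g]. *)
Lemma rist0_normalised K : normalised B K -> normalised B (rist0 K).
Proof.
move=> nK g x /basilica_sections0[h Bgh] Kx; rewrite /rist0 /=.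
by rewrite -(conj1g h) -tree_pairJ; apply: nK.
Qed.

Lemma rist01 K x : normalised B K -> rist0 K x -> K (tree_pair 1 x).
Proof. by move=> nK Kx; rewrite -(conj1g a) -tree_pairJb; apply: (nK _ _ Bb). Qed.

Lemma rist10 K x : normalised B K -> K (tree_pair 1 x) -> rist0 K x.
Proof.
move=> nK Kx; rewrite /rist0 /= -(conj1g a^-1) -tree_pairJbV.
by apply: (nK _ _ _ Kx); apply: (subgroupV sB Bb).
Qed.

Definition pairs (K : set tree_aut) : set tree_aut :=
  [set tree_pair x y | x in K & y in K].

Lemma pairs_subgroup K : subgroup K -> subgroup (pairs K).
Proof.
move=> sK; apply: subgroup_intro.
- by have K1 := subgroup1 sK; exists 1 => //; exists 1; rewrite ?tree_pair1.
- move=> _ _ [x Kx [y Ky <-]] [x' Kx' [y' Ky' <-]]; rewrite tree_pairM.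
  by exists (x * x'); [| exists (y * y') => //]; apply: subgroupM.
- move=> _ [x Kx [y Ky <-]]; rewrite tree_pairV.
  by exists x^-1; [| exists y^-1 => //]; apply: subgroupV.
Qed.

Lemma pairs_normalised K : normalised B K -> normalised B (pairs K).
Proof.
move=> nK; have nKJ g x : B g -> K x -> K (x ^ g) by apply: nK.
have pairJ x y g h : K x -> K y -> B g -> B h ->
    pairs K (tree_pair x y ^ tree_pair g h).
  move=> Kx Ky Bg Bh; rewrite tree_pairJ.
  by exists (x ^ g); [| exists (y ^ h) => //]; apply: nKJ.
move=> g _ /basilica_section[x' [y' [Bx' By' gE]]] [x Kx [y Ky <-]].
case: gE => ->; first exact: pairJ.
rewrite conjgM tree_pairJ tree_pairJb -conjgM.
exists (y ^ (y' * a)); last by exists (x ^ x') => //; apply: nKJ.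
by apply: nKJ => //; apply: (subgroupM sB By' Ba).
Qed.

Lemma pairsS K L : K `<=` L -> pairs K `<=` pairs L.
Proof. by move=> KL _ [x Kx [y Ky <-]]; exists x; [|exists y]; auto. Qed.

Lemma rist0_pairs K L : subgroup K -> normalised B K -> L `<=` rist0 K ->
  pairs L `<=` K.
Proof.
move=> sK nK LK _ [x /LK Kx [y /LK Ky <-]].
rewrite -[x]mulg1 -[y]mul1g -tree_pairM; apply: (subgroupM sK) => //.
exact: rist01.
Qed.

Lemma pairsR K : derived (pairs K) `<=` pairs (derived K).
Proof.
apply: derived_min; first exact: (pairs_subgroup (derived_subgroup K)).
move=> _ _ [x Kx [y Ky <-]] [x' Kx' [y' Ky' <-]]; rewrite tree_pairR.
by exists [~ x, x']; [| exists [~ y, y'] => //]; apply: derivedR.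
Qed.

Lemma pairs_fg K L : subgroup K -> subgroup L -> fg_mod K L ->
  fg_mod (pairs K) (pairs L).
Proof.
move=> sK sL [xs xsK Kgen]; have [K1 L1] := (subgroup1 sK, subgroup1 sL).
exists ([seq tree_pair x 1 | x <- xs] ++ [seq tree_pair 1 x | x <- xs]).
  move=> z /=; rewrite mem_cat => /orP[] /mapP[x /xsK Kx ->].
    by exists x => //; exists 1.
  by exists 1 => //; exists x.
set G := gen_subgroup _; have sG : subgroup G by apply: gen_subgroupP.
suff KG x : K x -> G (tree_pair x 1) /\ G (tree_pair 1 x).
  move=> _ [x /KG[Gx _] [y /KG[_ Gy] <-]].
  by rewrite -[x]mulg1 -[y]mul1g -tree_pairM; apply: (subgroupM sG).
move=> /Kgen; move: x; apply: gen_subgroup_min => [|x].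
  apply: subgroup_intro.
  - by rewrite tree_pair1; split; apply: (subgroup1 sG).
  - move=> x y [Gx Gx'] [Gy Gy']; rewrite -[1]mulg1 -!tree_pairM.
    by split; apply: (subgroupM sG).
  - move=> x [Gx Gx']; rewrite -[1]invg1 -!tree_pairV.
    by split; apply: (subgroupV sG).
move=> [Lx|xs_x]; split; apply: gen_subgroup_sub; [left|left|right|right].
- by exists x => //; exists 1.
- by exists 1 => //; exists x.
- by rewrite /= mem_cat; apply/orP; left; apply/mapP; exists x.
- by rewrite /= mem_cat; apply/orP; right; apply/mapP; exists x.
Qed.

(** * The subgroups [B'] and [B''] and their finitely generated factors *)

Local Notation B' := (derived basilica).
Local Notation B'' := (derived (derived basilica)).
Local Notation c := [~ basilica_a, basilica_b].

Lemma basilica_cE : c = tree_pair (b ^ a) b^-1.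
Proof.
by rewrite commgEl {2}basilica_aE tree_pairJb {1}basilica_aE tree_pairV tree_pairM
  invg1 mul1g mulg1.
Qed.

Lemma basilica_cJa : c ^ a = c.
Proof.
rewrite basilica_cE [X in _ ^ X]basilica_aE tree_pairJ conjg1.
by congr tree_pair; rewrite /conjg !gnorm.
Qed.

Lemma basilica_cJaV : c ^ a^-1 = c.
Proof. by rewrite -{1}basilica_cJa conjgK. Qed.

(** [B'] is the normal closure of [c], since [B] has the two generators [a] and [b]. *)
Lemma derived_basilica_min L : subgroup L -> normalised B L -> L c -> B' `<=` L.
Proof.
move=> sL nL Lc; apply: derived_gen_min => // _ _ [->|->] [->|->] //.
- by rewrite commgg; apply: subgroup1.
- by rewrite -invgR; apply: subgroupV.
- by rewrite commgg; apply: subgroup1.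
Qed.

Lemma derived_basilica_normalised : normalised B B'.
Proof. by apply: derived_normalised => g x Bg Bx; apply: (subgroupJ sB). Qed.

Lemma derived2_basilica_normalised : normalised B B''.
Proof. exact: (derived_normalised derived_basilica_normalised). Qed.

Local Notation nB' := derived_basilica_normalised.
Local Notation nB'' := derived2_basilica_normalised.
Local Notation sB' := (@derived_subgroup tree_aut basilica).
Local Notation sB'' := (@derived_subgroup tree_aut (derived basilica)).

Lemma derived_basilica_c : B' c.
Proof. exact: (derivedR Ba Bb). Qed.

Local Notation B'c := derived_basilica_c.

(** [B] is weakly branch over [B']: the pair [([b, a], 1)] is the commutator of [(b, 1)], a
    conjugate of [a], with [b * b = (a, a)]. *)
Lemma rist0_derived : B' `<=` rist0 B'.
Proof.
apply: derived_basilica_min; first exact: (rist0_subgroup sB').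
  exact: (rist0_normalised nB').
rewrite /rist0 /= -invgR -[1]invg1 -tree_pairV; apply: (subgroupV sB').
have -> : tree_pair [~ b, a] 1 = [~ tree_pair b 1, tree_pair a a].
  by rewrite tree_pairR comm1g.
rewrite -basilica_bb; apply: (derivedR basilica_pair_b1 _).
exact: (subgroupM sB Bb Bb).
Qed.

Lemma pairs_derived : pairs B' `<=` B'.
Proof. exact: (rist0_pairs sB' nB' rist0_derived). Qed.

(** Modulo [B' x B'] conjugation by [a] fixes [c] and conjugation by [b] inverts it, so the powers
    of [c] form a normal subgroup there. *)
Lemma derived_basilica_cyclic : B' `<=` gen_subgroup (pairs B' `|` [set c]).
Proof.
set S := pairs B' `|` _; have sS : subgroup (gen_subgroup S) by apply: gen_subgroupP.
have Sc : gen_subgroup S c by apply: gen_subgroup_sub; right.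
have NS x : pairs B' x -> gen_subgroup S x by move=> Nx; apply: gen_subgroup_sub; left.
have Bb' : B b^-1 by apply: (subgroupV sB Bb).
have B'ba : B' (b ^ a * b^-1).
  have -> : b ^ a * b^-1 = [~ a, b^-1] by rewrite /commg /conjg !gnorm.
  exact: (derivedR Ba Bb').
have B'1 : B' 1 := subgroup1 sB'.
have ScV : gen_subgroup S c^-1 by apply: (subgroupV sS Sc).
apply: (derived_basilica_min _ _ Sc) => //; apply: gen_normalised_gen => g x Sg [Nx|].
  have nN : normalised B (pairs B') by apply: (pairs_normalised nB').
  by case: Sg => ->; split; apply: NS; apply: nN => //;
    do ?apply: (subgroupV sB); do ?[exact: Ba | exact: Bb].
move=> ->; case: Sg => ->.
  by rewrite basilica_cJa basilica_cJaV.
split.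
  have -> : c ^ b = tree_pair 1 (b ^ a * b^-1) * c^-1.
    by rewrite basilica_cE tree_pairJb tree_pairV tree_pairM mul1g conjVg invgK mulgVK.
  by apply: (subgroupM sS _ ScV); apply: NS; exists 1 => //; exists (b ^ a * b^-1).
have -> : c ^ b^-1 = c^-1 * tree_pair (b ^ a * b^-1) 1.
  rewrite basilica_cE tree_pairJbV tree_pairV tree_pairM conjgK mulKg invgK mulg1.
  by [].
by apply: (subgroupM sS ScV); apply: NS; exists (b ^ a * b^-1) => //; exists 1.
Qed.

Lemma fg_derived_pairs : fg_mod B' (pairs B').
Proof.
exists [:: c]; first by move=> x; rewrite /= inE => /eqP->; apply: B'c.
apply: (subset_trans derived_basilica_cyclic).
by apply: gen_subgroupS => x [|->]; [left | right; rewrite /= mem_head].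
Qed.

(** The quotient of [B'] by [B' x B'] is cyclic, hence abelian. *)
Lemma derived2_pairs : B'' `<=` pairs B'.
Proof.
have nN := pairs_normalised nB'; have sN := pairs_subgroup sB'.
have B'_B := derived_sub sB; have cyc := derived_basilica_cyclic.
have S_B : gen_subgroup (pairs B' `|` [set c]) `<=` B.
  apply: gen_subgroup_min => [|x [/pairs_derived/B'_B//|->]]; first exact: sB.
  exact: B'_B B'c.
apply: (@subset_trans _ (derived (gen_subgroup (pairs B' `|` [set c])))).
  by apply: derived_min => [|x y /cyc Sx /cyc Sy]; [apply: derived_subgroup | apply: derivedR].
apply: derived_gen_min => //; first by move=> g x /S_B; apply: nN.
have Bc : B c := B'_B _ B'c.
have NR x y : B x -> pairs B' y -> pairs B' [~ x, y].
  move=> Bx Ny; rewrite commgEr; apply: (subgroupM sN) => //.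
  by apply: nN => //; apply: (subgroupV sN).
move=> x y [Nx|->] [Ny|->].
- exact: (subgroupR sN Nx Ny).
- by rewrite -invgR; apply: (subgroupV sN); apply: NR.
- exact: NR.
- by rewrite commgg; apply: (subgroup1 sN).
Qed.

(** Modulo [rist0 B''] the element [c] commutes with [a] and [b], so it generates its own normal
    closure [B']. *)
Lemma fg_derived_rist : fg_mod B' (rist0 B'').
Proof.
exists [:: c]; first by move=> x; rewrite /= inE => /eqP->; apply: B'c.
set S := rist0 B'' `|` _; have sS : subgroup (gen_subgroup S) by apply: gen_subgroupP.
have Sc : gen_subgroup S c by apply: gen_subgroup_sub; right; rewrite /= mem_head.
have WS x : rist0 B'' x -> gen_subgroup S x by move=> Nx; apply: gen_subgroup_sub; left.
have nW : normalised B (rist0 B'') := rist0_normalised nB''.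
have BV x : B x -> B x^-1 by apply: (subgroupV sB).
have [[Ba Bb] sW] := ((Ba, Bb), rist0_subgroup sB'').
(* As [c] is [(b ^ a, b^-1)], its commutator with [(c, 1)] is [([c, b ^ a], 1)],
   and [[c, b ^ a] = [c, b] ^ a] since [c] commutes with [a]. *)
have Wcb : rist0 B'' [~ c, b].
  rewrite -[X in rist0 B'' X](conjgK a); apply: nW; first exact: BV.
  rewrite conjRg basilica_cJa /rist0 /=.
  have -> : tree_pair [~ c, b ^ a] 1 = [~ tree_pair c 1, c].
    by rewrite {3}basilica_cE tree_pairR comm1g.
  by apply: derivedR; [apply: rist0_derived; apply: B'c | apply: B'c].
have Wcb' : rist0 B'' [~ c, b^-1].
  have -> : [~ c, b^-1] = [~ c, b]^-1 ^ b^-1 by rewrite /commg /conjg !gnorm.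
  by apply: nW; [apply: BV | apply: (subgroupV sW)].
apply: (derived_basilica_min _ _ Sc) => //; apply: gen_normalised_gen => g x Sg [Nx|].
  by case: Sg => ->; split; apply: WS; apply: nW => //; apply: BV.
rewrite /= inE => /eqP->; case: Sg => ->.
  by rewrite basilica_cJa basilica_cJaV.
by split; rewrite -(mulVKg c (c ^ _)); apply: (subgroupM sS) => //; apply: WS.
Qed.

Lemma fg_mod_trans (gT : groupType) (H K L : set gT) :
  K `<=` H -> fg_mod H K -> fg_mod K L -> fg_mod H L.
Proof.
move=> KH [xs xsH Hgen] [ys ysK Kgen]; exists (xs ++ ys).
  by move=> x /=; rewrite mem_cat => /orP[/xsH//|/ysK/KH].
apply: (subset_trans Hgen _); apply: gen_subgroup_min => [|x].
  exact: gen_subgroupP.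
case=> [/Kgen|xs_x]; last by apply: gen_subgroup_sub; right; rewrite /= mem_cat xs_x.
apply: gen_subgroupS => z [Lz|ys_z]; [by left | right].
by rewrite /= mem_cat orbC [z \in ys]ys_z.
Qed.

Lemma fg_modS (gT : groupType) (H K L : set gT) :
  K `<=` L -> fg_mod H K -> fg_mod H L.
Proof.
move=> KL [xs xsH Hgen]; exists xs => //.
by apply: (subset_trans Hgen _); apply: gen_subgroupS => x [/KL|]; [left|right].
Qed.

(** Passes through [B' x B']: the upper factor is cyclic, and below it [B''] contains the direct
    square of [rist0 B''], modulo which each factor [B'] is generated by [c]. *)
Lemma fg_derived_derived2 : fg_mod B' B''.
Proof.
apply: (fg_mod_trans pairs_derived fg_derived_pairs _).
apply: (@fg_modS _ _ (pairs (rist0 B''))).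
  exact: (rist0_pairs sB'' nB'' (@subset_refl _ _)).
by apply: pairs_fg fg_derived_rist; [apply: sB' | apply: (rist0_subgroup sB'')].
Qed.

(** * Direct powers with one factor below each vertex of a level *)

Definition levels (K : set tree_aut) (j : nat) : set tree_aut := iter j pairs K.

Lemma levels_subgroup K j : subgroup K -> subgroup (levels K j).
Proof. by move=> sK; elim: j => // j; apply: pairs_subgroup. Qed.

Lemma levels_normalised K j : normalised B K -> normalised B (levels K j).
Proof. by move=> nK; elim: j => // j; apply: pairs_normalised. Qed.

Lemma levelsS K L j : K `<=` L -> levels K j `<=` levels L j.
Proof. by move=> KL; elim: j => // j; apply: pairsS. Qed.

Lemma levelsR K j : derived (levels K j) `<=` levels (derived K) j.
Proof.
elim: j => // j IHj; apply: (subset_trans (@pairsR _) _); exact: pairsS.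
Qed.

Lemma levels_fg K L j : subgroup K -> subgroup L -> fg_mod K L ->
  fg_mod (levels K j) (levels L j).
Proof.
move=> sK sL fKL; elim: j => // j.
by apply: pairs_fg; apply: levels_subgroup.
Qed.

Lemma levels_pairs K j : levels (pairs K) j = levels K j.+1.
Proof. by rewrite /levels iterSr. Qed.

Lemma levels_derived_sub j : levels B' j `<=` B'.
Proof.
elim: j => // j; rewrite -levels_pairs => IHj.
exact: (subset_trans (levelsS pairs_derived) IHj).
Qed.

Lemma levels_derived2_sub j : levels B'' j `<=` B'.
Proof.
exact: (subset_trans (levelsS (derived_sub sB')) (@levels_derived_sub j)).
Qed.

(** Climbs from [levels B'' j] through [levels B' j], [levels B' (j - 1)] and so on to [B'] and [B].
    The factors are finitely generated abelian, so each term lies in [M] unless the index is finite;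
    [B] itself does not. *)
Lemma maximal_levels_finite_index M j : maximal_subgroup M B ->
  levels B'' j `<=` M -> finite_index M B.
Proof.
move=> maxM D_M; have [_ MB nMB _] := maxM.
have dBB : B' `<=` B := derived_sub sB.
have N_B i : levels B' i `<=` B by exact: (subset_trans (@levels_derived_sub i) dBB).
have step := maximal_abelian_step sB maxM.
have [N_M|//] : levels B' j `<=` M \/ finite_index M B.
  apply: (step (levels B'' j)) => //; first exact: (levels_normalised nB').
    split; try exact: (levels_subgroup _ sB').
    - exact: (levels_subgroup _ sB'').
    - exact: (levelsS (derived_sub sB')).
    - exact: levelsR.
  exact: (levels_fg _ sB' sB'' fg_derived_derived2).
have [B'M|//] : B' `<=` M \/ finite_index M B.
  elim: j N_M {D_M} => [|j IHj] N_M; first by left.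
  have [||||/IHj//|] := step (levels B' j.+1) (levels B' j) _ _ _ _ N_M; last by right.
  - exact: (levels_normalised nB').
  - exact: N_B.
  - split; try exact: (levels_subgroup _ sB').
      by rewrite -levels_pairs; apply: (levelsS pairs_derived).
    apply: (subset_trans (@levelsR _ _)); rewrite -levels_pairs.
    exact: (levelsS derived2_pairs).
  - by rewrite -levels_pairs; apply: (levels_fg _ sB' (pairs_subgroup sB') fg_derived_pairs).
have [B_M|//] : B `<=` M \/ finite_index M B.
  apply: (step B') => //; first by move=> g x Bg Bx; apply: (subgroupJ sB).
    by split=> //; [apply: sB | apply: sB'].
  exists [:: a; b].
    by move=> x; rewrite /= !inE => /orP[]/eqP->; [apply: Ba | apply: Bb].
  apply: gen_subgroupS => x [->|->]; right; rewrite /= !inE eqxx ?orbT //.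
by case: nMB; apply/seteqP.
Qed.

(** * The action on the first level, separating [B'] from [B''] *)

Definition swaps (g : tree_aut) : bool := g [:: false] == [:: true].

Lemma swaps_pair x y : swaps (tree_pair x y) = false.
Proof. by rewrite /swaps /= tfun_root. Qed.

Lemma swaps_pair_b x y : swaps (tree_pair x y * b) = true.
Proof. by rewrite /swaps /= tfun_root. Qed.

Lemma swapsM g h : B g -> B h -> swaps (g * h) = swaps g (+) swaps h.
Proof.
move=> /basilica_section[x [y [_ _ gE]]] /basilica_section[x' [y' [_ _ hE]]].
by case: gE hE => -> [] ->; rewrite ?swaps_pair ?swaps_pair_b /swaps /= ?tfun_root.
Qed.

Lemma swapsV g : B g -> swaps g^-1 = swaps g.
Proof.
move=> Bg; have := swapsM (subgroupV sB Bg) Bg.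
by rewrite mulVg -tree_pair1 swaps_pair; case: swaps; case: swaps.
Qed.

Lemma swapsJ g h : B g -> B h -> swaps (g ^ h) = swaps g.
Proof.
move=> Bg Bh; rewrite !swapsM ?swapsV //; try exact: (subgroupM sB _ _).
  by rewrite addbC -addbA addbb addbF.
exact: (subgroupV sB _).
Qed.

Lemma swapsR g h : B g -> B h -> swaps [~ g, h] = false.
Proof.
move=> Bg Bh; rewrite swapsM ?swapsJ ?swapsV ?addbb //.
  exact: (subgroupV sB).
exact: (subgroupJ sB).
Qed.

(* The elements of [B'] act on both subtrees of the root with the same parity,
   and this common parity vanishes on [B'']. *)
Lemma derived2_basilica_proper : ~ B' `<=` B''.
Proof.
pose Q (t : bool) := [set g : tree_aut | exists x y,
  [/\ B x, B y, g = tree_pair x y & swaps x = swaps y /\ (t -> swaps x = false)]].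
have sQ t : subgroup (Q t).
  have BM x y : B x -> B y -> B (x * y) by apply: (subgroupM sB).
  have BV x : B x -> B x^-1 by apply: (subgroupV sB).
  apply: subgroup_intro.
  - have B1 := subgroup1 sB; exists 1, 1; split; rewrite ?tree_pair1 //.
  - move=> _ _ [x [y [Bx By -> [xy xt]]]] [x' [y' [Bx' By' -> [xy' xt']]]].
    exists (x * x'), (y * y'); split; rewrite ?tree_pairM //; try exact: BM.
    rewrite !swapsM // xy xy'; split=> // tt; rewrite -xy -xy' xt // xt' //.
  - move=> _ [x [y [Bx By -> [xy xt]]]].
    by exists x^-1, y^-1; split; rewrite ?tree_pairV ?swapsV //; apply: BV.
have nQ t : normalised B (Q t).
  apply: normalised_gen => g _ Sg [x [y [Bx By -> [xy xt]]]].
  have BJ u v : B u -> B v -> B (u ^ v) by apply: (subgroupJ sB).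
  have Ba' : B a^-1 := subgroupV sB Ba; have Bb' : B b^-1 := subgroupV sB Bb.
  have [[Ba Bb] B1] := ((Ba, Bb), subgroup1 sB).
  case: Sg => ->; last first.
    rewrite tree_pairJb tree_pairJbV; split.
      exists (y ^ a), x; split; rewrite ?swapsJ //; first exact: BJ.
      by split=> // /xt; rewrite xy.
    exists y, (x ^ a^-1); split; rewrite ?swapsJ //; first exact: BJ.
    by split=> // /xt; rewrite xy.
  rewrite basilica_aE tree_pairV !tree_pairJ; split.
    by exists (x ^ 1), (y ^ b); split; rewrite ?swapsJ //; apply: BJ.
  rewrite invg1.
  by exists (x ^ 1), (y ^ b^-1); split; rewrite ?swapsJ //; apply: BJ.
have cE : c = tree_pair (b ^ a) b^-1 := basilica_cE.
have [Bba Bb'] := (subgroupJ sB Bb Ba, subgroupV sB Bb).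
have [ba_s b_s] : swaps (b ^ a) = true /\ swaps b^-1 = true.
  by rewrite swapsJ ?swapsV //; [apply: Bb | apply: Bb | apply: Ba].
have B'Q : B' `<=` Q false.
  apply: derived_basilica_min => //.
  by exists (b ^ a), b^-1; split; rewrite ?ba_s ?b_s.
have B''Q : B'' `<=` Q true.
  apply: derived_min => // _ _ /B'Q[x [y [Bx By -> _]]] /B'Q[x' [y' [Bx' By' -> _]]].
  exists [~ x, x'], [~ y, y']; rewrite tree_pairR; split; rewrite ?swapsR //.
    exact: (subgroupR sB _ _).
  exact: (subgroupR sB _ _).
(* The sections [b ^ a] and [b^-1] of [c] both swap the first level, so [c] is not in [Q true]. *)
move=> B'B''; have [x [y [_ _]]] := B''Q _ (B'B'' _ B'c).
by rewrite cE => /tree_pair_inj[<- _] [_ /(_ isT)]; rewrite ba_s.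
Qed.

(** * Nontrivial normal subgroups contain some [levels B'' j] *)

Fixpoint below (v : word) (x : tree_aut) : tree_aut :=
  match v with
  | [::] => x
  | false :: v' => tree_pair (below v' x) 1
  | true :: v' => tree_pair 1 (below v' x)
  end.

Lemma belowM v x y : below v (x * y) = below v x * below v y.
Proof. by elim: v => [|[] v IHv] //=; rewrite IHv tree_pairM mulg1. Qed.

Lemma below1 v : below v 1 = 1.
Proof. by apply: (mulgI (below v 1)); rewrite -belowM !mulg1. Qed.

Lemma belowV v x : below v x^-1 = (below v x)^-1.
Proof. by apply: (mulgI (below v x)); rewrite -belowM !mulgV below1. Qed.

Lemma belowR v x y : below v [~ x, y] = [~ below v x, below v y].
Proof. by rewrite /commg /conjg !(belowM, belowV). Qed.

Lemma derived_below v x : B' x -> B' (below v x).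
Proof.
move=> B'x; elim: v => [|[] v IHv] //=; last exact: rist0_derived.
exact: (rist01 nB' (rist0_derived IHv)).
Qed.

(* [below v x ^ k] is supported below [k^-1 v], a vertex other than [v] on the
   same level, hence commutes with [below v y] and drops out. *)
Lemma below_double_comm k v x y : B k -> k v != v ->
  [~ [~ k, below v x], below v y] = below v [~ x, y].
Proof.
elim: v k => [|l v IHv] k Bk; first by rewrite tfun_root eqxx.
have [k0 [k1 [Bk0 Bk1 [->|->]]]] := basilica_section Bk.
  by case: l => /=; rewrite eqseq_cons eqxx /= => kv;
    rewrite !tree_pairR ?(commg1, comm1g) IHv.
move=> _; rewrite [[~ _ * b, _]]commgEr conjVg.
case: l => /=; rewrite conjgM tree_pairJ conj1g tree_pairJb ?conj1g;
  by rewrite tree_pairV tree_pairM tree_pairR ?(invg1, mulg1, mul1g) commg1 belowR.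
Qed.

(** Normality spreads [B''] from one vertex to its whole level: [rist0 K] is again normal, and
    conjugation by [b] exchanges the two halves of the tree. *)
Lemma levels_sub_normal K v : subgroup K -> normalised B K ->
  (forall z, B'' z -> K (below v z)) -> levels B'' (size v) `<=` K.
Proof.
elim: v K => [|l v IHv] K sK nK DK; first by move=> z; apply: DK.
apply: rist0_pairs => //; apply: IHv; first exact: rist0_subgroup.
  exact: rist0_normalised.
move=> z B''z; have := DK z B''z; case: l {DK} => //=.
exact: rist10.
Qed.

(** Some [k] in [K] moves a vertex [v]; the double commutators of [k] with copies of [B'] below [v]
    lie in [K] and generate the copy of [B''] below [v]. *)
Lemma normal_levels K : subgroup K -> normalised B K -> K `<=` B ->
  (exists2 k, K k & k <> 1) -> exists j, levels B'' j `<=` K.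
Proof.
move=> sK nK KB [k Kk k1].
have [v kv] : exists v, k v != v.
  apply: contrapT => kv; apply: k1; apply: tree_aut_inj => v /=.
  by apply/eqP; apply: contrapT => /negP kv'; apply: kv; exists v.
exists (size v); apply: levels_sub_normal => //.
have KR x y : B x -> K y -> K [~ x, y].
  move=> Bx Ky; rewrite commgEr; apply: subgroupM => //.
  by apply: nK => //; apply: subgroupV.
pose S := [set z | K (below v z)].
suff sub : B'' `<=` S by move=> z /sub.
apply: derived_min => [|x y B'x B'y]; last first.
  have B'_B := derived_sub sB.
  rewrite /S /= -(below_double_comm _ _ (KB _ Kk) kv) -invgR.
  apply: subgroupV => //; apply: (KR); first by apply: B'_B; apply: derived_below.
  rewrite -invgR; apply: subgroupV => //; apply: (KR) => //.
  by apply: B'_B; apply: derived_below.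
apply: subgroup_intro; rewrite /S /=.
- by rewrite below1; apply: subgroup1.
- by move=> x y Kx Ky; rewrite belowM; apply: subgroupM.
- by move=> x Kx; rewrite belowV; apply: subgroupV.
Qed.

(** * Prodense subgroups and their groups of sections *)

(** By [normal_levels] this amounts to [M N = B] for every nontrivial normal subgroup [N] of [B]. *)
Definition prodense (M : set tree_aut) : Prop :=
  [/\ subgroup M, M `<=` B & forall j g, B g ->
    exists2 m, M m & exists2 d, levels B'' j d & g = m * d].

Definition proper_prodense (M : set tree_aut) : Prop :=
  prodense M /\ ~ B `<=` M.

Lemma maximal_prodense M : maximal_subgroup M B -> ~ finite_index M B ->
  proper_prodense M.
Proof.
move=> maxM iM; have [sM MB nMB Mmax] := maxM; split; last first.
  by move=> BM; apply: nMB; apply/seteqP.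
split=> // j; set D := levels B'' j.
have sD : subgroup D by apply: (levels_subgroup _ sB'').
have nD : normalised B D by apply: (levels_normalised nB'').
have DB : D `<=` B.
  exact: (subset_trans (@levels_derived2_sub j) (derived_sub sB)).
pose Q := [set g | exists2 m, M m & exists2 d, D d & g = m * d].
have sQ : subgroup Q.
  apply: subgroup_intro.
  - by exists 1; [apply: subgroup1 | exists 1; [apply: subgroup1 | rewrite mulg1]].
  - move=> _ _ [m Mm [d Dd ->]] [m' Mm' [d' Dd' ->]].
    exists (m * m'); first exact: subgroupM.
    exists (d ^ m' * d').
      by apply: subgroupM => //; apply: nD => //; apply: MB.
    by rewrite /conjg !gnorm.
  - move=> _ [m Mm [d Dd ->]]; exists m^-1; first exact: subgroupV.
    exists (d^-1 ^ m^-1); last by rewrite /conjg !gnorm.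
    by apply: nD; [apply: MB|]; apply: subgroupV.
have DQ : D `<=` Q.
  by move=> d Dd; exists 1; [apply: subgroup1 | exists d; rewrite ?mul1g].
have [|_ [m Mm [d Dd ->]]|QM|QB] := Mmax Q sQ.
- move=> m Mm; exists m => //; exists 1; rewrite ?mulg1 //; exact: subgroup1.
- by apply: (subgroupM sB); [apply: MB | apply: DB].
- case: iM; apply: (maximal_levels_finite_index maxM) => d /DQ.
  by rewrite QM.
- by move=> g Bg; have : Q g by rewrite QB.
Qed.

Lemma proper_prodenseJ M h : B h -> proper_prodense M ->
  proper_prodense [set g | M (g ^ h)].
Proof.
move=> Bh [[sM MB dM] pM]; split; last first.
  move=> BM; apply: pM => g Bg; rewrite -(conjgKV h g).
  by apply: BM; apply: (subgroupJ sB) => //; apply: (subgroupV sB).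
split.
- apply: subgroup_intro => /=.
  + by rewrite conj1g; apply: subgroup1.
  + by move=> x y Mx My; rewrite conjMg; apply: subgroupM.
  + by move=> x Mx; rewrite conjVg; apply: subgroupV.
- move=> g /MB Bgh; rewrite -(conjgK h g).
  by apply: (subgroupJ sB) => //; apply: (subgroupV sB).
- move=> j g Bg; have [m Mm [d Dd gE]] := dM j (g ^ h) (subgroupJ sB Bg Bh).
  exists (m ^ h^-1); first by rewrite /= conjgKV.
  exists (d ^ h^-1); last by rewrite -conjMg -gE conjgK.
  by apply: (levels_normalised nB'') => //; apply: (subgroupV sB).
Qed.

(** Density: an element [(h, g)] of [B] is corrected into [M] by a pair from level [j + 1].
    Properness: if the sections were all of [B], then [M] would contain some [levels B'' j], hence
    be [B]. *)
Lemma proper_prodense_sections M : proper_prodense M ->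
  proper_prodense (sections M).
Proof.
move=> [[sM MB dM] pM]; have nD j := @levels_normalised _ j nB''.
have sMs := sections_subgroup sM; split; first split=> //.
- by move=> y [x /MB/basilica_pair_in[]].
- move=> j g /basilica_sections[h /(dM j.+1)[m Mm [_ [d Dd [e De <-]] gE]]].
  exists (g * e^-1); last by exists e => //; rewrite mulgVK.
  exists (h * d^-1); rewrite -tree_pairM -tree_pairV gE mulgK //.
move=> BMs; apply: pM.
(* Correcting [b] by a pair from [B''] gives an element of [M] that exchanges the two halves of the
   tree. *)
have [m0 [p [q [Bp Bq Mm0 m0J]]]] : exists m0 p q, [/\ B p, B q, M m0 &
    forall x y, tree_pair x y ^ m0 = tree_pair (y ^ p) (x ^ q)].
  have [m Mm [_ [d Dd [e De <-]] bE]] := dM 1%N b Bb.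
  have D_B : B'' `<=` B by apply: (subset_trans (derived_sub sB') (derived_sub sB)).
  have [Bd Be] := (D_B _ Dd, D_B _ De).
  exists m, (a * d^-1), e^-1; split=> //.
  - by apply: (subgroupM sB Ba); apply: (subgroupV sB _).
  - exact: (subgroupV sB _).
  - move=> x y; have -> : m = b * (tree_pair d e)^-1 by rewrite bE mulgK.
    by rewrite conjgM tree_pairJb tree_pairV tree_pairJ conjgM.
have BMs0 : B `<=` sections0 M.
  move=> x Bx; have [y My] := BMs (x ^ p^-1) (subgroupJ sB Bx (subgroupV sB Bp)).
  exists (y ^ q); rewrite -(conjgKV p x) -m0J; exact: subgroupJ.
(* The rigid stabiliser of the vertex 1 in [M], normal in [B] because the sections of [M] at 1 are
   assumed to fill [B]. *)
pose K := [set y | M (tree_pair 1 y)].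
have sK : subgroup K.
  apply: subgroup_intro; rewrite /K /=.
  - by rewrite tree_pair1; apply: subgroup1.
  - by move=> x y Mx My; rewrite -[1]mulg1 -tree_pairM; apply: subgroupM.
  - by move=> x Mx; rewrite -[1]invg1 -tree_pairV; apply: subgroupV.
have nK : normalised B K.
  move=> g x /BMs[h Mh] Mx; rewrite /K /= -(conj1g h) -tree_pairJ.
  exact: subgroupJ.
have KB : K `<=` B by move=> y /MB/basilica_pair_in[].
pose R x y := M (tree_pair x y).
have lift : forall x, B'' x -> exists2 y, B'' y & R x y.
  have R1 : R 1 1 by rewrite /R tree_pair1; apply: subgroup1.
  have RM x x' y y' : R x y -> R x' y' -> R (x * x') (y * y').
    by move=> Rx Rx'; rewrite /R -tree_pairM; apply: subgroupM.
  have RV x y : R x y -> R x^-1 y^-1.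
    by move=> Rx; rewrite /R -tree_pairV; apply: subgroupV.
  apply: (derived_rel R1 RM RV); apply: (derived_rel R1 RM RV) => x Bx.
  have [y My] := BMs0 x Bx; exists y => //.
  by have [] := basilica_pair_in (MB _ My).
have [j DK] : exists j, levels B'' j `<=` K.
  (* Suppose [K] is trivial. For [y] in [B'], the pair [(1, y)] corrected into [M] is
     [(d^-1, y e^-1)]. A lift [(d^-1, f)] with [f] in [B''] must coincide with it, so [y = f e] lies
     in [B''], which fails for some [y]. *)
  apply: normal_levels => //; apply: contrapT => K1.
  apply: derived2_basilica_proper => y B'y.
  have B1y : B (tree_pair 1 y).
    by apply: (derived_sub sB); apply: (rist01 nB' (rist0_derived B'y)).
  have [m Mm [_ [d Dd [e De <-]] yE]] := dM 1%N _ B1y.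
  have mE : m = tree_pair d^-1 (y * e^-1).
    by rewrite -(mul1g d^-1) -tree_pairM yE -tree_pairV mulgK.
  have [f B''f Mf] := lift d^-1 (subgroupV sB'' Dd).
  have : K (f^-1 * (y * e^-1)).
    rewrite /K /= -(mulVg d^-1) -tree_pairM -tree_pairV -mE.
    by apply: subgroupM => //; apply: subgroupV.
  move=> Kf; have fE : f^-1 * (y * e^-1) = 1.
    by apply: contrapT => f1; apply: K1; exists (f^-1 * (y * e^-1)).
  have -> : y = f * e.
    by rewrite -(mulgVK e y) -[y * e^-1](mulKg f^-1) fE invgK mulg1.
  exact: (subgroupM sB'' _ _).
(* [K] supplies the second coordinates, and conjugation by [m0] carries them to the first. *)
have sub : levels B'' j.+1 `<=` M.
  move=> _ [x Dx [y Dy <-]]; rewrite -[x]mulg1 -[y]mul1g -tree_pairM.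
  apply: subgroupM => //; last exact: DK.
  have : M (tree_pair 1 (x ^ p^-1) ^ m0).
    by apply: subgroupJ => //; apply: DK; apply: nD => //; apply: (subgroupV sB).
  by rewrite m0J conjgKV conj1g.
by move=> g /(dM j.+1)[m Mm [d Dd ->]]; apply: subgroupM => //; apply: sub.
Qed.

(** * Words *)

(* The letter [(g, s)] stands for [b] if [g] and [a] otherwise, inverted if [s]. *)
Local Notation letter := (bool * bool)%type.

Definition letter_val (l : letter) : tree_aut :=
  let x := if l.1 then b else a in if l.2 then x^-1 else x.

(* The leftmost letter acts first. *)
Fixpoint eval (w : seq letter) : tree_aut :=
  if w is l :: w' then eval w' * letter_val l else 1.

Lemma eval_cat u v : eval (u ++ v) = eval v * eval u.
Proof. by elim: u => [|l u IHu] /=; rewrite ?mulg1 // IHu mulgA. Qed.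

(** The section of the letter [l] at the vertex [s], a word of at most one letter. *)
Definition emit (s : bool) (l : letter) : seq letter :=
  if l.1 then if s == l.2 then [:: (false, l.2)] else [::]
  else if s then [:: (true, l.2)] else [::].

(** The section of [w] at [s]; each [b] or its inverse moves [s] to the other vertex. *)
Fixpoint trace (s : bool) (w : seq letter) : seq letter :=
  if w is l :: w' then emit s l ++ trace (s (+) l.1) w' else [::].

Definition state (s : bool) (w : seq letter) : bool := s (+) odd (count fst w).

Lemma trace_cat s u v : trace s (u ++ v) = trace s u ++ trace (state s u) v.
Proof.
rewrite /state; elim: u s => [|l u IHu] s /=; first by rewrite addbF.
by rewrite IHu oddD oddb addbA catA.
Qed.

Lemma eval_trace s w u : eval w (s :: u) = state s w :: eval (trace s w) u.
Proof.
rewrite /state; elim: w s u => [|l w IHw] s u /=; first by rewrite addbF.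
rewrite oddD oddb addbA eval_cat.
have -> : letter_val l (s :: u) = s (+) l.1 :: eval (emit s l) u.
  by case: l s => [[] []] [].
by rewrite IHw.
Qed.

Lemma eval_even w : ~~ odd (count fst w) ->
  eval w = tree_pair (eval (trace false w)) (eval (trace true w)).
Proof.
move=> /negPf w0; apply: tree_aut_inj => -[|s u]; first by rewrite !tfun_root.
by rewrite eval_trace /state w0 addbF; case: s.
Qed.

Definition next (w : seq letter) : seq letter := trace true w ++ trace false w.

Lemma next_odd M w : subgroup M -> odd (count fst w) -> M (eval w) ->
  sections M (eval (next w)).
Proof.
move=> sM w1 Mw; exists (eval (trace false (w ++ w))).
have -> : next w = trace true (w ++ w) by rewrite trace_cat /state w1.
by rewrite -eval_even ?count_cat ?oddD ?w1 // eval_cat; apply: subgroupM.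
Qed.

(** The element [a * b] carries 1 to 0 with trivial section at 1, so the product of [w] with its
    conjugate by [a * b] has section [next w] at 1. *)
Lemma next_even M w : subgroup M -> M (a * b) -> ~~ odd (count fst w) ->
  M (eval w) -> sections M (eval (next w)).
Proof.
move=> sM Mab w0 Mw.
pose t := [:: (true, false); (false, false)].
pose t' := [:: (false, true); (true, true)].
exists (eval (trace false (w ++ t ++ w ++ t'))).
have -> : next w = trace true (w ++ t ++ w ++ t').
  by rewrite trace_cat trace_cat trace_cat /state /= (negPf w0) /= cats0.
rewrite -eval_even; last by rewrite !count_cat !oddD (negPf w0).
rewrite !eval_cat; have -> : eval t = a * b by rewrite /= mul1g.
have -> : eval t' = (a * b)^-1 by rewrite /= mul1g invgM.
do 3![apply: subgroupM => //]; exact: subgroupV.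
Qed.

Lemma sections_ab M : subgroup M -> M (a * b) -> sections M (b * a).
Proof.
move=> sM Mab.
have := @next_odd M [:: (true, false); (false, false)] sM isT.
by rewrite /= !mul1g; apply.
Qed.

Lemma sections_ba M : subgroup M -> M (b * a) -> sections M (a * b).
Proof.
move=> sM Mba.
have := @next_odd M [:: (false, false); (true, false)] sM isT.
by rewrite /= !mul1g; apply.
Qed.

(** * Letter counts and exponent sums *)

(** Each letter emits in exactly one of the two traces, with [a] and [b] exchanged and the sign
    kept. *)
Lemma count_next g s w :
  count_mem (g, s) (next w) = count_mem (~~ g, s) w.
Proof.
rewrite /next count_cat; suff tr t : (count_mem (g, s) (trace t w) +
    count_mem (g, s) (trace (~~ t) w) = count_mem (~~ g, s) w)%N by exact: (tr true).
elim: w t => //= -[g' s'] w IHw t; rewrite !count_cat addnACA /= addNb IHw.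
by congr (_ + _)%N; case: g g' s s' t {IHw} => [] [] [] [] [].
Qed.

Lemma size_next w : size (next w) = size w.
Proof.
rewrite /next size_cat; suff tr t : (size (trace t w) +
    size (trace (~~ t) w) = size w)%N by exact: (tr true).
elim: w t => //= -[g' s'] w IHw t; rewrite !size_cat addnACA /= addNb IHw.
by case: g' s' t => [] [] [].
Qed.

(* The exponent sums of [a] and [b] in [w] are [i] and [j]. *)
Definition balance (i j : nat) (w : seq letter) : Prop :=
  count_mem (false, false) w = (count_mem (false, true) w + i)%N /\
  count_mem (true, false) w = (count_mem (true, true) w + j)%N.

Lemma balance_next i j w : balance i j w -> balance j i (next w).
Proof. by rewrite /balance !count_next => -[]. Qed.

Lemma count_fst w :
  count fst w = (count_mem (true, false) w + count_mem (true, true) w)%N.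
Proof. by elim: w => //= -[[] []] w /= ->; rewrite ?addnS. Qed.

Lemma balance_odd i j w : balance i j w -> odd (count fst w) = odd j.
Proof. by case=> _ bw; rewrite count_fst bw addnAC addnn oddD odd_double. Qed.

Definition letter_inv (l : letter) : letter := (l.1, ~~ l.2).

Lemma letter_valV l : letter_val (letter_inv l) = (letter_val l)^-1.
Proof. by case: l => [g []]; rewrite /letter_val /= ?invgK. Qed.

Lemma eval_cancel u l v : eval (u ++ l :: letter_inv l :: v) = eval (u ++ v).
Proof. by rewrite !eval_cat /= letter_valV mulgVK. Qed.

Lemma balance_cancel i j u l v :
  balance i j (u ++ l :: letter_inv l :: v) -> balance i j (u ++ v).
Proof.
rewrite /balance !count_cat /=; case: l => [[] []] /= [h1 h2]; split;
  move: h1 h2; rewrite ?(add0n, add1n, addnS, addSn); lia.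
Qed.

Lemma first_split (T : eqType) (x : T) s : x \in s ->
  exists s1 s2, s = s1 ++ x :: s2 /\ x \notin s1.
Proof.
elim: s => // y s IHs; rewrite inE; have [->|xy /= /IHs[s1 [s2 [-> xs1]]]] := eqVneq x y.
  by exists [::], s.
by exists (y :: s1), s2; rewrite inE negb_or xy.
Qed.

Lemma last_split (T : eqType) (x : T) s : x \in s ->
  exists s1 s2, s = s1 ++ x :: s2 /\ x \notin s2.
Proof.
rewrite -mem_rev => /first_split[s1 [s2 [sE xs1]]]; exists (rev s2), (rev s1).
by rewrite mem_rev -[s]revK sE rev_cat rev_cons cat_rcons.
Qed.

(** * Cancellation in [next w] *)

Definition only_a (w : seq letter) : bool := all (fun l => ~~ l.1) w.

Lemma only_aP w : (true, false) \notin w -> (true, true) \notin w -> only_a w.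
Proof.
move=> w1 w2; apply/allP => -[[] []] //= lw; first by rewrite lw in w2.
by rewrite lw in w1.
Qed.

Lemma only_a_count w : only_a w -> count fst w = 0.
Proof. by elim: w => // -[[] s] w IHw //= /IHw->. Qed.

Lemma only_a_trace w : only_a w -> trace false w = [::].
Proof. by elim: w => // -[[] s] w IHw //= /IHw. Qed.

(* Read cyclically, [w] has a [b^-1] and a later [b] separated by letters
   [a^(+-1)] only; on one of the two passes they emit [a^-1] and [a] with
   nothing in between. *)
Lemma next_cancel w : odd (count fst w) ->
    (true, false) \in w -> (true, true) \in w ->
  exists u v, next w = u ++ (false, true) :: (false, false) :: v.
Proof.
move=> w_odd wb wB.
have [[u [v [wE vb]]]|noP] := pselect (exists u v,
    w = u ++ (true, true) :: v /\ (true, false) \in v).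
  have [v1 [v2 [vE v1b]]] := first_split vb.
  have [q [A [qE AB]]] := last_split (mem_head (true, true) v1).
  have aA : only_a A.
    apply: only_aP => //; apply: (contra _ v1b) => Ab.
    have : (true, false) \in (true, true) :: v1 by rewrite qE mem_cat inE Ab !orbT.
    by rewrite inE.
  have {}wE : w = (u ++ q) ++ (true, true) :: A ++ (true, false) :: v2.
    rewrite wE vE -!catA; congr (u ++ _); rewrite -cat_cons qE -catA.
    by [].
  (* Reached in state 1, [b^-1] emits [a^-1] and leads to state 0, where [A] emits nothing and the
     next [b] emits [a]. *)
  have cancels s : state s (u ++ q) = true -> exists u' v',
      trace s w = u' ++ (false, true) :: (false, false) :: v'.
    move=> st; exists (trace s (u ++ q)), (trace true v2).
    rewrite wE trace_cat st /= [trace _ (A ++ _)]trace_cat (only_a_trace aA).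
    by rewrite /state (only_a_count aA).
  rewrite /next; have [uq_odd|uq_even] := boolP (odd (count fst (u ++ q))).
    have [|u' [v' ->]] := cancels false; first by rewrite /state uq_odd.
    by exists (trace true w ++ u'), v'; rewrite -catA.
  have [|u' [v' ->]] := cancels true; first by rewrite /state (negPf uq_even).
  by exists u', (v' ++ trace false w); rewrite -catA.
(* Otherwise every [b] precedes every [b^-1]. The cancelling pair then straddles the junction of the
   two traces, from the last [b^-1] to the first [b]; oddness gives the right state. *)
have [u [v [wE uB]]] := first_split wB.
have vb : (true, false) \notin v by apply/negP => vb; apply: noP; exists u, v.
have ub : (true, false) \in u.
  by move: wb; rewrite wE mem_cat inE (negPf vb) !orbF.
have [A1 [q [uE A1b]]] := first_split ub.
have [q' [A2 [q'E A2B]]] := last_split (mem_head (true, true) v).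
have aA1 : only_a A1.
  by apply: only_aP => //; apply: (contra _ uB) => A1B; rewrite uE mem_cat A1B.
have aA2 : only_a A2.
  apply: only_aP => //; apply: (contra _ vb) => A2b.
  have : (true, false) \in (true, true) :: v by rewrite q'E mem_cat inE A2b !orbT.
  by rewrite inE.
have w1E : w = (u ++ q') ++ (true, true) :: A2 by rewrite wE q'E catA.
have w2E : w = A1 ++ (true, false) :: (q ++ (true, true) :: v).
  by rewrite wE uE -catA.
exists (trace true (u ++ q')), (trace true (q ++ (true, true) :: v)).
rewrite /next [in trace true w]w1E [in trace false w]w2E.
rewrite trace_cat [state true _](_ : _ = true).
  rewrite /= (only_a_trace aA2) -catA; congr (_ ++ _); congr (_ :: _).
  rewrite [trace false (A1 ++ _)]trace_cat (only_a_trace aA1).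
  by rewrite /state (only_a_count aA1).
move: w_odd; rewrite w1E /state [in odd _]count_cat /= (only_a_count aA2) addn0 addn1.
by rewrite oddS.
Qed.

Lemma only_a_eval w : only_a w ->
  eval w * a ^+ count_mem (false, true) w = a ^+ count_mem (false, false) w.
Proof.
elim: w => [|[[] []] w IHw] //= aw; first by rewrite mulg1.
  by rewrite add1n add0n expgS /letter_val /= -mulgA mulKg IHw.
rewrite add1n add0n /letter_val /= -mulgA -expgS expgSr mulgA IHw //.
by rewrite -expgSr.
Qed.

Lemma balance_next_reduce i w : balance i 1 w -> (true, true) \in w ->
  exists2 w', size w' < size w & balance 1 i w' /\ eval w' = eval (next w).
Proof.
move=> bal_w wB; have w_odd := balance_odd bal_w.
have wb : (true, false) \in w.
  by rewrite -has_pred1 has_count; case: bal_w => _ ->; rewrite addn1.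
have [//|u [v nE]] := next_cancel _ wb wB.
exists (u ++ v); first by rewrite -(size_next w) nE !size_cat /= !addnS.
split; last by rewrite nE (eval_cancel u (false, true)).
by apply: (@balance_cancel _ _ _ (false, true)); rewrite -nE; apply: balance_next.
Qed.

Lemma balance_one_b i w : balance i 1 w -> (true, true) \notin w ->
  exists A1 A2, [/\ w = A1 ++ (true, false) :: A2, only_a A1 & only_a A2].
Proof.
move=> [_]; rewrite -has_pred1 has_count -eqn0Ngt => wb /eqP wB.
have b_w : (true, false) \in w by rewrite -has_pred1 has_count wb addn1.
have [A1 [A2 [wE A1b]]] := first_split b_w.
move: wb wB; rewrite wE !count_cat (count_memPn A1b) /= => wb /eqP.
rewrite addn_eq0 => /andP[/eqP A1B /eqP A2B].
exists A1, A2; split=> //; apply: only_aP => //; apply/count_memPn => //.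
by move: wb; rewrite A1B A2B add0n => -[].
Qed.

(** * Elements of [B] and [B'] as words *)

Definition inv_word (w : seq letter) : seq letter := rev (map letter_inv w).

Lemma eval_inv_word w : eval (inv_word w) = (eval w)^-1.
Proof.
elim: w => [|l w IHw] /=; first by rewrite invg1.
have -> : inv_word (l :: w) = inv_word w ++ [:: letter_inv l].
  by rewrite cats1 -rev_cons.
by rewrite eval_cat IHw /= mul1g letter_valV invgM.
Qed.

Lemma words_of_basilica g : B g -> exists w, g = eval w.
Proof.
move: g; apply: basilica_min.
- apply: subgroup_intro.
  + by exists [::].
  + by move=> _ _ [u ->] [v ->]; exists (v ++ u); rewrite eval_cat.
  + by move=> _ [w ->]; exists (inv_word w); rewrite eval_inv_word.
- by exists [:: (false, false)]; rewrite /= mul1g.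
- by exists [:: (true, false)]; rewrite /= mul1g.
Qed.

Lemma balance_cat i j i' j' u v : balance i j u -> balance i' j' v ->
  balance (i + i') (j + j') (u ++ v).
Proof. by rewrite /balance !count_cat => -[-> ->] [-> ->]; lia. Qed.

Lemma count_inv_word g s w : count_mem (g, s) (inv_word w) = count_mem (g, ~~ s) w.
Proof.
rewrite /inv_word count_rev count_map; apply: eq_count => -[g' s'] /=.
by rewrite !xpair_eqE; case: s s' => [] [].
Qed.

Lemma derived_word g : B' g -> exists2 w, balance 0 0 w & g = eval w.
Proof.
move: g; apply: derived_basilica_min.
- apply: subgroup_intro.
  + by exists [::].
  + move=> _ _ [u bu ->] [v bv ->]; exists (v ++ u); last by rewrite eval_cat.
    exact: (balance_cat bv bu).
  + move=> _ [w [bw1 bw2] ->]; exists (inv_word w); last by rewrite eval_inv_word.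
    by split; rewrite !count_inv_word /= ?bw1 ?bw2 !addn0.
- move=> _ _ /words_of_basilica[u ->] [w [bw1 bw2] ->].
  exists (u ++ w ++ inv_word u); last first.
    by rewrite !eval_cat eval_inv_word /conjg mulgA.
  split; rewrite !count_cat !count_inv_word /= ?bw1 ?bw2 !addn0;
    by rewrite addnCA [RHS]addnCA; congr (_ + _)%N; apply: addnC.
- exists ([:: (true, false); (false, false); (true, true); (false, true)]) => //.
  by rewrite /= mul1g /commg /conjg !gnorm.
Qed.

(** Correcting by an element of [B''], a subgroup of [B'], leaves the exponent sums unchanged. *)
Lemma prodense_word M w i j : prodense M -> balance i j w ->
  exists2 w', balance i j w' & M (eval w').
Proof.
move=> [sM MB dM] bw.
have Bw : B (eval w).
  elim: w {bw} => [|l w IHw] /=; first exact: (subgroup1 sB).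
  apply: (subgroupM sB IHw _); case: l => [[] []]; rewrite /letter_val /=;
    by do ?apply: (subgroupV sB _); [apply: Bb || apply: Ba].
have [m Mm [d Dd wE]] := dM 0 _ Bw.
have [v bv dE] := derived_word (subgroupV sB' (levels_derived2_sub Dd)).
exists (v ++ w); last by rewrite eval_cat -dE wE mulgK.
by rewrite -[i]add0n -[j]add0n; apply: balance_cat.
Qed.

(** * Descent on conjugates of [b] by powers of [a] *)

Lemma basilica_of_a_ba M : subgroup M -> M a -> M (b * a) -> B `<=` M.
Proof.
move=> sM Ma Mba; apply: basilica_min => //.
exact: (subgroupMr sM Ma Mba).
Qed.

(** The square of [b ^ x] is [(a, a ^ u)], so [a ^ u] is a section. It equals [(1, b ^ y)] or
    [(b ^ y, 1)]; in the second case conjugation by the section [a * b] exchanges the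
    coordinates. *)
Lemma conj_descent M x u y : subgroup M -> M (b * a) -> M (b ^ x) ->
    x = tree_pair 1 u -> u = tree_pair y y \/ u = tree_pair y y * b^-1 ->
  sections (sections M) (b * a) /\ sections (sections M) (b ^ y).
Proof.
move=> sM Mba Mbx xE uE.
have sM1 := sections_subgroup sM; have M1ab := sections_ba sM Mba.
split; first exact: sections_ab.
have M1au : sections M (a ^ u).
  exists a; have -> : tree_pair a (a ^ u) = (b * b) ^ x.
    by rewrite basilica_bb xE tree_pairJ conjg1.
  by rewrite conjMg; apply: subgroupM.
case: uE => uE.
  by exists 1; rewrite -[1](conj1g y) -tree_pairJ -basilica_aE -uE.
exists 1; have -> : tree_pair 1 (b ^ y) = (a ^ u) ^ (a * b).
  rewrite uE (conjgM a) {1}basilica_aE tree_pairJ tree_pairJbV conj1g conjgM.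
  have -> : tree_pair (b ^ y) (1 ^ a^-1) ^ a = tree_pair (b ^ y) 1.
    by rewrite [X in _ ^ X]basilica_aE tree_pairJ conjg1 !conj1g.
  by rewrite tree_pairJb conj1g.
exact: subgroupJ.
Qed.

Lemma expg_b2 n : b ^+ (n.*2) = tree_pair (a ^+ n) (a ^+ n).
Proof. by rewrite -mul2n expgnA expg2 basilica_bb tree_pairX. Qed.

Lemma aX_pair n : a ^+ n = tree_pair 1 (b ^+ n).
Proof. by rewrite basilica_aE tree_pairX expg1n. Qed.

(** Two section steps halve [n], down to 0 or 1, where [b ^ (a ^+ n)] and [b * a] generate [B]. *)
Lemma conj_aX_false n M : proper_prodense M -> M (b * a) -> ~ M (b ^ (a ^+ n)).
Proof.
elim/ltn_ind: n M => -[|[|n]] IHn M ppM Mba; have [[sM _ _] pM] := ppM.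
- rewrite expg0 conjg1 => Mb; apply: pM; apply: basilica_of_a_ba => //.
  exact: (subgroupMl sM Mb Mba).
- rewrite expg1 => Mba'; apply: pM; apply: basilica_of_a_ba => //.
  have -> : a = (b * a) * (b ^ a)^-1 by rewrite /conjg !gnorm.
  exact: subgroupF.
(* Rounding up: an odd exponent is written [2q - 1], giving the factor [b^-1] that [conj_descent]
   allows. This fixes 1, hence the second base case. *)
move=> Mbx; pose q := uphalf n.+2.
have [M2ba M2b] : sections (sections M) (b * a) /\
    sections (sections M) (b ^ (a ^+ q)).
  apply: (conj_descent sM Mba Mbx (aX_pair _) _); rewrite -expg_b2.
  have := uphalfK n.+2; rewrite -/q; case: (odd _) => ->; [right|by left].
  by rewrite add1n [in RHS]expgSr mulgK.
apply: (IHn q _ _ _ M2ba) => //; last by do 2!apply: proper_prodense_sections.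
by rewrite /q; lia.
Qed.

(** Here an odd exponent is [-(2q + 1)], so halving rounds towards 0 and always ends at 0. *)
Lemma conj_aXV_false n M : proper_prodense M -> M (b * a) -> ~ M (b ^ (a ^- n)).
Proof.
elim/ltn_ind: n M => -[|n] IHn M ppM Mba; have [[sM _ _] pM] := ppM.
  by rewrite invg1; apply: (conj_aX_false (n := 0)).
move=> Mbx; pose q := n.+1./2.
have xE : a ^- n.+1 = tree_pair 1 (b ^- n.+1) by rewrite aX_pair tree_pairV invg1.
have [M2ba M2b] : sections (sections M) (b * a) /\
    sections (sections M) (b ^ (a ^- q)).
  apply: (conj_descent sM Mba Mbx xE _); rewrite -tree_pairV -expg_b2.
  have := odd_double_half n.+1; rewrite -/q; case: (odd _) => <-; [right|by left].
  by rewrite add1n expgS invgM.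
apply: (IHn q _ _ _ M2ba) => //; last by do 2!apply: proper_prodense_sections.
by rewrite /q; lia.
Qed.

(** * Excluding elements with exponent sums [(0, 1)] and [(1, 1)] *)

Lemma only_a_power w : only_a w ->
  exists n, eval w = a ^+ n \/ eval w = a ^- n.
Proof.
move=> /only_a_eval; set m := count_mem _ w; set n := count_mem _ w => wE.
have {}wE : eval w = a ^+ n / a ^+ m by rewrite -wE mulgK.
have [mn|nm] := leqP m n; first by exists (n - m); left; rewrite expgnFr.
exists (m - n); right; rewrite expgnFr; last exact: ltnW.
by rewrite invgM invgK.
Qed.

(** If [b^-1] occurs, two section steps take the exponent sums through [(1, 0)] back to [(0, 1)],
    and [b * a] through [a * b] back to itself, with a shorter word. Otherwise [w] is a conjugate of
    [b] by a power of [a]. *)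
Lemma proper_prodense_b_ba n M w : proper_prodense M -> M (b * a) ->
  size w <= n -> balance 0 1 w -> ~ M (eval w).
Proof.
elim: n M w => [|n IHn] M w ppM Mba w_n bal_w Mw.
  by case: w w_n bal_w {Mw} => // _ [].
have [[sM _ _] _] := ppM; have sM1 := sections_subgroup sM.
have [wB|wB] := boolP ((true, true) \in w).
  have [w1 w1_w [bal_w1 w1E]] := balance_next_reduce bal_w wB.
  apply: (IHn (sections (sections M)) (next w1)).
  - by do 2!apply: proper_prodense_sections.
  - by apply: sections_ab => //; apply: sections_ba.
  - by rewrite size_next -ltnS; exact: leq_trans w1_w w_n.
  - exact: balance_next.
  - apply: next_even => //; first exact: sections_ba.
      by rewrite (balance_odd bal_w1).
    by rewrite w1E; apply: next_odd => //; rewrite (balance_odd bal_w).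
have [A1 [A2 [wE aA1 aA2]]] := balance_one_b bal_w wB.
have A21 : eval A2 * eval A1 = 1.
  rewrite -eval_cat; apply: (mulIg (a ^+ count_mem (false, true) (A1 ++ A2))).
  rewrite only_a_eval /only_a ?all_cat ?mul1g; last exact/andP.
  by case: bal_w; rewrite wE addn0 !count_cat /= => -> _.
have {}Mw : M (b ^ eval A1).
  move: Mw; rewrite wE eval_cat /= /letter_val /= -mulgA.
  by rewrite -[eval A2](mulgK (eval A1)) A21 mul1g.
have [m [A1E|A1E]] := only_a_power aA1; rewrite A1E in Mw.
  exact: (conj_aX_false ppM Mba Mw).
exact: (conj_aXV_false ppM Mba Mw).
Qed.

(** Section steps shorten [w] until [b^-1] is gone. Then [w] is a conjugate of [b * a], and a
    conjugate of [M] contains [b * a] together with some element of exponent sums [(0, 1)]. *)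
Lemma proper_prodense_ab n M w : proper_prodense M ->
  size w <= n -> balance 1 1 w -> ~ M (eval w).
Proof.
elim: n M w => [|n IHn] M w ppM w_n bal_w Mw.
  by case: w w_n bal_w {Mw} => // _ [].
have [[sM _ _] _] := ppM.
have [wB|wB] := boolP ((true, true) \in w).
  have [w1 w1_w [bal_w1 w1E]] := balance_next_reduce bal_w wB.
  apply: (IHn (sections M) w1 _ _ bal_w1).
  - exact: proper_prodense_sections.
  - by rewrite -ltnS; exact: leq_trans w1_w w_n.
  - by rewrite w1E; apply: next_odd => //; rewrite (balance_odd bal_w).
have [A1 [A2 [wE aA1 aA2]]] := balance_one_b bal_w wB.
have balA : only_a (A1 ++ A2) by rewrite /only_a all_cat; apply/andP.
have A21 : eval A2 * eval A1 = a.
  rewrite -eval_cat; apply: (mulIg (a ^+ count_mem (false, true) (A1 ++ A2))).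
  rewrite only_a_eval // -expgS.
  by case: bal_w; rewrite wE addn1 !count_cat /= => -> _.
have BA1 : B (eval A1).
  have [m [->|->]] := only_a_power aA1; last apply: (subgroupV sB _).
    exact: (subgroupX _ sB Ba).
  exact: (subgroupX _ sB Ba).
(* The values of [A1] and [A2] are powers of [a] with product [a], so [w] has value [A1^-1 a b A1],
   the conjugate of [b * a] by [h]. *)
pose h := a^-1 * eval A1.
have Bh : B h := subgroupM sB (subgroupV sB Ba) BA1.
have Mba : M ((b * a) ^ h).
  suff -> : (b * a) ^ h = eval w by [].
  have -> : (b * a) ^ h = (eval A1)^-1 * a * b * eval A1.
    by rewrite /h /conjg !gnorm.
  rewrite wE eval_cat /= /letter_val /=; congr (_ * _ * _).
  have ca : commute a (eval A1).
    by have [m [->|->]] := only_a_power aA1;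
      [apply: commuteX | apply: commuteV; apply: commuteX].
  by rewrite -[eval A2](mulgK (eval A1)) A21; apply: (mulgI (eval A1));
    rewrite mulVKg mulgA -ca mulgK.
have ppMh := proper_prodenseJ Bh ppM.
have [|w' bal_w' Mw'] := @prodense_word _ [:: (true, false)] 0 1 ppMh.1; first by [].
exact: (proper_prodense_b_ba ppMh Mba (leqnn _) bal_w').
Qed.

Theorem theorem4p28 (M : set tree_aut) (hM : maximal_subgroup M basilica) :
  finite_index M basilica.
Proof.
apply: contrapT => iM; have ppM := maximal_prodense hM iM.
have [|w bal_w Mw] := @prodense_word _ [:: (false, false); (true, false)] 1 1 ppM.1.
  by [].
exact: (proper_prodense_ab ppM (leqnn _) bal_w Mw).
Qed.
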